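(* Let $0<\alpha<2$. If $(\mathbf X,\mathbf Y)$ is a pair of random vectors in Euclidean spaces $\mathbb R^p$ and $\mathbb R^q$ (with $p,q\ge1$), then $\mathrm{dcov}^{\mathsf E}_\alpha(\mathbf X,\mathbf Y)=\mathrm{dcov}^{\mathsf H}_\alpha(\mathbf X,\mathbf Y)$ (as elements of $[0,\infty]$; no moment conditions are assumed).
   Context: Definition of $\mathrm{dcov}^{\mathsf E}_\alpha$ for random vectors $\mathbf X\in\mathbb R^p$, $\mathbf Y\in\mathbb R^q$: let $\varphi_{\mathbf X}(\mathbf t)=\mathbb E e^{\mathrm i\mathbf t\cdot\mathbf X}$, $\varphi_{\mathbf Y}(\mathbf u)=\mathbb E e^{\mathrm i\mathbf u\cdot\mathbf Y}$, $\varphi_{\mathbf X,\mathbf Y}(\mathbf t,\mathbf u)=\mathbb E e^{\mathrm i(\mathbf t\cdot\mathbf X+\mathbf u\cdot\mathbf Y)}$ be the characteristic functions, and $$c_{\alpha,k}:=\frac{\alpha2^{\alpha-1}\Gamma((k+\alpha)/2)}{\pi^{k/2}\Gamma(1-\alpha/2)}.$$ Then $$\mathrm{dcov}^{\mathsf E}_\alpha(\mathbf X,\mathbf Y):=c_{\alpha,p}c_{\alpha,q}\int_{\mathbb R^p}\int_{\mathbb R^q}\bigl|\varphi_{\mathbf X,\mathbf Y}(\mathbf t,\mathbf u)-\varphi_{\mathbf X}(\mathbf t)\varphi_{\mathbf Y}(\mathbf u)\bigr|^2\frac{d\mathbf t\,d\mathbf u}{|\mathbf t|^{p+\alpha}|\mathbf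 u|^{q+\alpha}}\in[0,\infty].$$ Definition of $\mathrm{dcov}^{\mathsf H}_\alpha$ for random variables $\mathbf X,\mathbf Y$ in separable Hilbert spaces $\mathcal H,\mathcal H'$ (real scalars): fix orthonormal bases $(\mathbf e_i)_i$ of $\mathcal H$ and $(\mathbf e'_j)_j$ of $\mathcal H'$, and i.i.d. $N(0,1)$ random variables $\xi_i$, $1\le i\le\dim\mathcal H$, and $\eta_j$, $1\le j\le\dim\mathcal H'$, all independent of each other and of $(\mathbf X,\mathbf Y)$; write $\boldsymbol\xi=(\xi_i)_i$, $\boldsymbol\eta=(\eta_j)_j$, $\boldsymbol\xi\cdot\mathbf x:=\sum_i\langle\mathbf x,\mathbf e_i\rangle\xi_i$ and $\boldsymbol\eta\cdot\mathbf y:=\sum_j\langle\mathbf y,\mathbf e'_j\rangle\eta_j$ (a.s. convergent). With $c_\alpha:=\alpha2^{\alpha/2}/\Gamma(1-\alpha/2)$, $$\mathrm{dcov}^{\mathsf H}_\alpha(\mathbf X,\mathbf Y):=c_\alpha^2\int_0^\infty\!\!\int_0^\infty\mathbb E\Bigl|\mathbb E\bigl(e^{\mathrm ir\boldsymbol\xi\cdot\mathbf X+\mathrm is\boldsymbol\eta\cdot\mathbf Y}\mid\boldsymbol\xi,\boldsymbol\eta\bigr)-\mathbb E\bigl(e^{\mathrm ir\boldsymbol\xi\cdot\mathbf X}\mid\boldsymbol\xi\bigr)\mathbb E\bigl(e^{\mathrm is\boldsymbol\eta\cdot\mathbf Y}\mid\boldsymbol\eta\bigr)\Bigr|^2\frac{dr\,ds}{r^{\alpha+1}s^{\alpha+1}}\in[0,\infty].$$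 In the claim this is used with $\mathcal H=\mathbb R^p$, $\mathcal H'=\mathbb R^q$. *)

(* Defs.v *)
From HB Require Import structures.
From mathcomp Require Import all_boot all_order all_algebra.
From mathcomp Require Import all_classical all_reals all_analysis.
From mathcomp Require Import complex.

Set Implicit Arguments.
Unset Strict Implicit.
Unset Printing Implicit Defensive.

Import Order.TTheory GRing.Theory Num.Theory.
Import numFieldNormedType.Exports.

Local Open Scope classical_set_scope.
Local Open Scope ring_scope.

(* R^n is n.-tuple R rather than 'rV[R]_n: tuples carry the library's product
   (= Borel) sigma-algebra. *)
Section euclidean.
Context {R : realType}.

Definition dotv n (x y : n.-tuple R) : R := \sum_(i < n) tnth x i * tnth y i.

Definition norm2 n (x : n.-tuple R) : R := Num.sqrt (dotv x x).

Definition orthonormal_basis n (e : 'I_n -> n.-tuple R) : Prop :=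
  (forall i j, dotv (e i) (e j) = (i == j)%:R) /\
  (forall x : n.-tuple R, exists c : 'I_n -> R,
     forall k, tnth x k = \sum_(i < n) c i * tnth (e i) k).

(* xi . x := sum_i <x, e_i> xi_i *)
Definition basis_dot n (e : 'I_n -> n.-tuple R) (xi : 'I_n -> R)
    (x : n.-tuple R) : R :=
  \sum_(i < n) dotv x (e i) * xi i.

End euclidean.

Section power_measure.
Context d (T : measurableType d) (R : realType).
Local Open Scope ereal_scope.

Definition consv n (z : T * n.-tuple T) : n.+1.-tuple T :=
  [tuple of z.1 :: z.2].

Lemma measurable_consv n : measurable_fun setT (@consv n).
Proof. exact: (@measurable_cons _ _ _ _ fst n snd). Qed.

Fixpoint power_measure (mu : set T -> \bar R) (n : nat) :
    set (n.-tuple T) -> \bar R :=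
  if n is m.+1
  then pushforward (mu \x @power_measure mu m) (@consv m)
  else \d_([tuple] : 0.-tuple T).

End power_measure.

Section power_measure_theory.
Context d (T : measurableType d) (R : realType).
Variable mu : {sigma_finite_measure set T -> \bar R}.
Local Open Scope ereal_scope.

Let measurable_uncons n :
  measurable_fun setT (fun t : n.+1.-tuple T => (thead t, [tuple of behead t])).
Proof.
apply/measurable_fun_pairP; split; first exact: measurable_tnth.
exact: measurable_behead.
Qed.

Let sigma_finite_pushforward_consv n
    (m : {sigma_finite_measure set (n.-tuple T) -> \bar R}) :
  sigma_finite setT (pushforward (mu \x m) (@consv _ T n)).
Proof.
have /sigma_finiteP[F [FT ndF mF]] := sigma_finiteT mu.
have /sigma_finiteP[G [GT ndG mG]] := sigma_finiteT m.
pose g (t : n.+1.-tuple T) := (thead t, [tuple of behead t]).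
have gK : g \o @consv _ T n = id.
  by apply/funext => -[x t]; rewrite /g /consv/=; congr pair; apply/val_inj.
exists (fun k => g @^-1` (F k `*` G k)).
  apply/esym; rewrite -subTset => t _.
  have [k _ Fk] : (\bigcup_k F k) (g t).1 by rewrite -FT.
  have [l _ Gl] : (\bigcup_k G k) (g t).2 by rewrite -GT.
  exists (maxn k l) => //; split.
    by move: Fk; exact/subsetPset/ndF/leq_maxl.
  by move: Gl; exact/subsetPset/ndG/leq_maxr.
move=> k; have [? ?] := mF k; have [? ?] := mG k; split.
  rewrite -[X in measurable X]setTI.
  by apply: measurable_uncons => //; exact: measurableX.
rewrite /pushforward -comp_preimage gK preimage_id.
by rewrite product_measure1E// lte_mul_pinfty// ge0_fin_numE.
Qed.

Let power_measure_ex n :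
  exists m : {sigma_finite_measure set (n.-tuple T) -> \bar R},
    (m : set (n.-tuple T) -> \bar R) = @power_measure _ T R mu n.
Proof.
elim: n => [|n [m' IH]]; first by exists (\d_([tuple] : 0.-tuple T)).
rewrite /= -IH.
pose mc := @measurable_consv _ T n.
pose nu : {measure set (n.+1.-tuple T) -> \bar R} :=
  measure_function_pushforward__canonical__measure_function_Measure
    (mu \x m' : {measure set _ -> \bar R}) mc.
pose sf := Measure_isSigmaFinite.Build _ _ _ (Measure.sort nu)
  (sigma_finite_pushforward_consv m').
by exists (HB.pack_for {sigma_finite_measure set (n.+1.-tuple T) -> \bar R}
  (Measure.sort nu) sf).
Qed.

Let power_measure0 n : @power_measure _ T R mu n set0 = 0.
Proof. by have [m <-] := power_measure_ex n; exact: measure0. Qed.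

Let power_measure_ge0 n A : 0 <= @power_measure _ T R mu n A.
Proof. by have [m <-] := power_measure_ex n; exact: measure_ge0. Qed.

Let power_measure_sigma_additive n :
  semi_sigma_additive (@power_measure _ T R mu n).
Proof.
by have [m <-] := power_measure_ex n; exact: measure_semi_sigma_additive.
Qed.

HB.instance Definition _ n := isMeasure.Build _ _ _
  (@power_measure _ T R mu n)
  (@power_measure0 n) (@power_measure_ge0 n) (@power_measure_sigma_additive n).

Let power_measure_sigma_finite n :
  sigma_finite setT (@power_measure _ T R mu n).
Proof. by have [m <-] := power_measure_ex n; exact: sigma_finiteT. Qed.

HB.instance Definition _ n := Measure_isSigmaFinite.Build _ _ _
  (@power_measure _ T R mu n) (@power_measure_sigma_finite n).

Lemma power_measure_box n (A : 'I_n -> set T) :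
  (forall i, measurable (A i)) ->
  @power_measure _ T R mu n [set t | forall i, A i (tnth t i)] =
  \prod_(i < n) mu (A i).
Proof.
elim: n A => [|n IH] A mA /=.
  by rewrite big_ord0 diracE mem_set//= => -[].
rewrite big_ord_recl -IH => [|i]; last exact: mA.
rewrite -product_measure1E//.
  congr (_ \x _) => /=; apply/seteqP.
  split=> -[x t] /=.
    move=> h; split=> [|i]; first exact: (h ord0).
    by have := h (lift ord0 i); rewrite tnthS.
  by move=> -[/= h0 h] i; case: (unliftP ord0 i) => [j ->|->//]; rewrite tnthS.
rewrite (_ : [set t | _] = \bigcap_(i in setT)
    ((fun t : n.-tuple T => tnth t i) @^-1` A (lift ord0 i))).
  apply: fin_bigcap_measurable => // i _; rewrite -[X in measurable X]setTI.
  exact: measurable_tnth.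
by apply/seteqP; split => t /= h i; [move=> _|]; exact: h.
Qed.

End power_measure_theory.

Section lebesgue_measuren.
Context (R : realType).
Local Open Scope ereal_scope.

Definition lebesgue_measuren (n : nat) :
    set (n.-tuple (measurableTypeR R)) -> \bar R :=
  @power_measure _ _ R (@lebesgue_measure R) n.

HB.instance Definition _ n := SigmaFiniteMeasure.on (@lebesgue_measuren n).

Lemma lebesgue_measuren_box n (a b : 'I_n -> R) :
  (forall i, a i <= b i)%R ->
  @lebesgue_measuren n [set t | forall i, (a i <= tnth t i <= b i)%R] =
  (\prod_(i < n) (b i - a i))%:E.
Proof.
move=> ab.
rewrite /lebesgue_measuren.
have -> : [set t : n.-tuple (measurableTypeR R) |
      forall i, (a i <= tnth t i <= b i)%R] =
    [set t | forall i, `[a i, b i]%classic (tnth t i)].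
  by apply/seteqP; split=> t /= h i; have := h i; rewrite in_itv.
have mab i : measurable (`[a i, b i]%classic : set (measurableTypeR R)).
  exact: measurable_itv.
rewrite (power_measure_box lebesgue_measure mab).
rewrite -prodEFin; apply: eq_bigr => i _.
rewrite [LHS](lebesgue_measure_itv `[a i, b i])/= lte_fin EFinB.
by case: ltgtP (ab i) => // ->; rewrite subee.
Qed.

End lebesgue_measuren.

Section constants.
Context {R : realType}.

Definition Gamma (x : R) : R :=
  \int[lebesgue_measure]_(t in `]0, +oo[) (t `^ (x - 1) * expR (- t)).

Definition c_const (alpha : R) (k : nat) : R :=
  alpha * 2 `^ (alpha - 1) * Gamma ((k%:R + alpha) / 2) /
  (pi `^ (k%:R / 2) * Gamma (1 - alpha / 2)).

Definition cH_const (alpha : R) : R :=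
  alpha * 2 `^ (alpha / 2) / Gamma (1 - alpha / 2).

Definition expi (x : R) : R[i] := (cos x +i* sin x)%C.

(* squared modulus, as an element of R *)
Definition sqmod (z : R[i]) : R := Normc.normc z ^+ 2.

End constants.

Section dcovE.
Context d (T : measurableType d) (R : realType) (P : probability T R).
Local Open Scope ereal_scope.

Definition Cexpectation (Z : T -> R[i]) : R[i] :=
  (fine 'E_P[fun w => complex.Re (Z w)] +i*
   fine 'E_P[fun w => complex.Im (Z w)])%C.

Definition char_fun n (X : T -> n.-tuple R) (t : n.-tuple R) : R[i] :=
  Cexpectation (fun w => expi (dotv t (X w))).

Definition joint_char_fun p q (X : T -> p.-tuple R) (Y : T -> q.-tuple R)
    (t : p.-tuple R) (u : q.-tuple R) : R[i] :=
  Cexpectation (fun w => expi (dotv t (X w) + dotv u (Y w))%R).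

(* At t = 0 or u = 0, a null set as p, q >= 1, the integrand takes the
   conventional value 0. *)
Definition dcovE (alpha : R) p q (X : T -> p.-tuple R) (Y : T -> q.-tuple R) :
    \bar R :=
  (c_const alpha p * c_const alpha q)%:E *
  \int[@lebesgue_measuren R p]_t \int[@lebesgue_measuren R q]_u
    (sqmod (joint_char_fun X Y t u - char_fun X t * char_fun Y u) /
     (norm2 t `^ (p%:R + alpha) * norm2 u `^ (q%:R + alpha)))%:E.

End dcovE.

Section conditional_expectation.
Context d (T : measurableType d) (R : realType) (P : probability T R).
Local Open Scope ereal_scope.

(* the sigma-algebra generated by V *)
Definition sigma_of d' (T' : measurableType d') (V : T -> T') : set (set T) :=
  preimage_set_system setT V measurable.

(* W is a version of E(Z | G) *)
Definition is_cond_expectation (G : set (set T)) (Z W : T -> R) : Prop :=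
  [/\ forall B, measurable B -> G (W @^-1` B),
      P.-integrable setT (EFin \o W) &
      forall A, G A -> \int[P]_(w in A) (W w)%:E = \int[P]_(w in A) (Z w)%:E].

(* E(Z | V); versions agree P-almost surely, one is chosen by [get] *)
Definition cond_expectation d' (T' : measurableType d') (V : T -> T')
    (Z : T -> R) : T -> R :=
  get [set W | is_cond_expectation (sigma_of V) Z W].

Definition Ccond_expectation d' (T' : measurableType d') (V : T -> T')
    (Z : T -> R[i]) (w : T) : R[i] :=
  (cond_expectation V (fun w' => complex.Re (Z w')) w +i*
   cond_expectation V (fun w' => complex.Im (Z w')) w)%C.

Definition mutually_independent (I : finType) (F : I -> set (set T)) : Prop :=
  forall (J : {set I}) (A : I -> set T), (forall i, i \in J -> F i (A i)) ->
    P (\bigcap_(i in [set i | i \in J]) A i) = \prod_(i in J) P (A i).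

End conditional_expectation.

Section dcovH.
Context d (T : measurableType d) (R : realType) (P : probability T R).
Context (p q : nat) (X : T -> p.-tuple R) (Y : T -> q.-tuple R).
Context (e : 'I_p -> p.-tuple R) (e' : 'I_q -> q.-tuple R).
Context (xi : 'I_p -> T -> R) (eta : 'I_q -> T -> R).
Local Open Scope ereal_scope.

(* the xi_i and eta_j are i.i.d. N(0,1), and independent of (X, Y) *)
Definition gaussian_system : Prop :=
  [/\ forall i, measurable_fun setT (xi i),
      forall j, measurable_fun setT (eta j),
      forall i (B : set R), measurable B ->
        P (xi i @^-1` B) = normal_prob 0%R 1%R B,
      forall j (B : set R), measurable B ->
        P (eta j @^-1` B) = normal_prob 0%R 1%R B &
      mutually_independent P (fun k : option ('I_p + 'I_q)%type =>
        match k with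
        | None => sigma_of (fun w => (X w, Y w))
        | Some (inl i) => sigma_of (xi i)
        | Some (inr j) => sigma_of (eta j)
        end)].

Let xiv w := [tuple xi i w | i < p].
Let etav w := [tuple eta j w | j < q].
Let xiX w := basis_dot e (xi ^~ w) (X w).
Let etaY w := basis_dot e' (eta ^~ w) (Y w).

Definition cond_char_diff (r s : R) (w : T) : R[i] :=
  (Ccond_expectation P (fun w => (xiv w, etav w))
     (fun w => expi (r * xiX w + s * etaY w)) w -
   Ccond_expectation P xiv (fun w => expi (r * xiX w)) w *
   Ccond_expectation P etav (fun w => expi (s * etaY w)) w)%R.

Definition dcovH (alpha : R) : \bar R :=
  (cH_const alpha ^+ 2)%:E *
  \int[lebesgue_measure]_(r in `]0%R, +oo[)
  \int[lebesgue_measure]_(s in `]0%R, +oo[)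
    ('E_P[fun w => sqmod (cond_char_diff r s w)] *
     ((r `^ (alpha + 1) * s `^ (alpha + 1))^-1)%:E).

End dcovH.

(* Every pair (X, Y) has, on a suitable extension pr of its probability space,
   Gaussian variables as required by gaussian_system. *)
Section gaussian_extension.
Context d (T : measurableType d) (R : realType) (P : probability T R).
Context (p q : nat) (X : {RV P >-> p.-tuple R}) (Y : {RV P >-> q.-tuple R}).
Local Open Scope ereal_scope.

Let N01 : probability (measurableTypeR R) R := normal_prob 0%R 1%R.
Let N0 n : {measure set (n.-tuple (measurableTypeR R)) -> \bar R} :=
  @power_measure _ _ R N01 n.

Let mbox n (A : 'I_n -> set (measurableTypeR R)) :
  (forall i, measurable (A i)) ->
  measurable [set t : n.-tuple (measurableTypeR R) | forall i, A i (tnth t i)].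
Proof.
move=> mA.
rewrite (_ : [set t | _] = \bigcap_(i in setT)
    ((fun t : n.-tuple (measurableTypeR R) => tnth t i) @^-1` A i)).
  apply: fin_bigcap_measurable => // i _; rewrite -[X in measurable X]setTI.
  exact: measurable_tnth.
by apply/seteqP; split => t /= h i; [move=> _|]; exact: h.
Qed.

Let N0_setT n : N0 n setT = 1.
Proof.
rewrite (_ : setT = [set t : n.-tuple (measurableTypeR R) |
    forall i : 'I_n, setT (tnth t i)]).
  rewrite /N0/= (power_measure_box N01 (fun i : 'I_n => measurableT)).
  by rewrite big1// => i _; exact: probability_setT.
by apply/seteqP; split.
Qed.

Let N n : probability (n.-tuple (measurableTypeR R)) R :=
  HB.pack (Measure.sort (N0 n))
    (Measure_isProbability.Build _ _ _ (Measure.sort (N0 n)) (N0_setT n)).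

Let T' :=
  (T * (p.-tuple (measurableTypeR R) * q.-tuple (measurableTypeR R)))%type.
Let NN : probability
    (p.-tuple (measurableTypeR R) * q.-tuple (measurableTypeR R))%type R :=
  @N p \x @N q.
Let P' : probability T' R := P \x NN.

Let P'_box (C : set T) (A : 'I_p -> set R) (B : 'I_q -> set R) :
  measurable C -> (forall i, measurable (A i)) ->
  (forall j, measurable (B j)) ->
  P' [set w : T' | [/\ C w.1, forall i, A i (tnth w.2.1 i) &
                       forall j, B j (tnth w.2.2 j)]] =
  P C * (\prod_(i < p) N01 (A i) * \prod_(j < q) N01 (B j)).
Proof.
move=> mC mA mB.
have mA' := @mbox p A mA.
have mB' := @mbox q B mB.
rewrite -(power_measure_box N01 mA) -(power_measure_box N01 mB).
have := product_measure1E (@N p) (@N q) mA' mB'.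
rewrite -[X in X = _ -> _]/(NN _) => <-.
have := product_measure1E P NN mC (measurableX mA' mB').
rewrite -[X in X = _ -> _]/(P' _) => <-.
by congr (P' _); apply/seteqP; split => -[w [x y]] /= => [[? ? ?]|[? [? ?]]].
Qed.

Let pr (w : T') : T := w.1.
Let mpr : measurable_fun setT pr. Proof. exact: measurable_fst. Qed.

Let xi (i : 'I_p) (w : T') : R := tnth w.2.1 i.
Let eta (j : 'I_q) (w : T') : R := tnth w.2.2 j.

Let mxi i : measurable_fun setT (xi i).
Proof.
apply: (@measurableT_comp _ _ _ _ _ _
  (fun x : p.-tuple (measurableTypeR R) => tnth x i)).
  exact: measurable_tnth.
by apply: measurableT_comp => //; exact: measurable_snd.
Qed.

Let meta j : measurable_fun setT (eta j).
Proof.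
apply: (@measurableT_comp _ _ _ _ _ _
  (fun x : q.-tuple (measurableTypeR R) => tnth x j)).
  exact: measurable_tnth.
by apply: measurableT_comp => //; exact: measurable_snd.
Qed.

Let prP (C : set T) : measurable C -> P' (pr @^-1` C) = P C.
Proof.
move=> mC; rewrite -[RHS]mule1 -(@probability_setT _ _ _ NN).
have := product_measure1E P NN mC measurableT.
rewrite -[X in X = _ -> _]/(P' _) => <-.
by congr (P' _); apply/seteqP; split => -[w z] //= [].
Qed.

Let xiP i (B : set R) : measurable B -> P' (xi i @^-1` B) = N01 B.
Proof.
move=> mB; pose A k : set (measurableTypeR R) := if k == i then B else setT.
have mA k : measurable (A k) by rewrite /A; case: ifP.
have := P'_box (@measurableT _ T) mA (fun=> measurableT).
rewrite probability_setT mul1e [X in _ * X]big1 => [|j _]; last first.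
  exact: probability_setT.
rewrite mule1 (bigD1 i)//= [X in _ * X]big1 => [|k /negPf ki]; last first.
  by rewrite /A ki; exact: probability_setT.
rewrite /A eqxx mule1 => <-; congr (P' _); apply/seteqP; split => w /=.
  by move=> Bw; split => // k; case: eqP => // ->.
by move=> [_ /(_ i)]; rewrite eqxx.
Qed.

Let etaP j (B : set R) : measurable B -> P' (eta j @^-1` B) = N01 B.
Proof.
move=> mB; pose A k : set (measurableTypeR R) := if k == j then B else setT.
have mA k : measurable (A k) by rewrite /A; case: ifP.
have := P'_box (@measurableT _ T) (fun=> measurableT) mA.
rewrite probability_setT mul1e [X in X * _]big1 => [|i _]; last first.
  exact: probability_setT.
rewrite mul1e (bigD1 j)//= [X in _ * X]big1 => [|k /negPf kj]; last first.
  by rewrite /A kj; exact: probability_setT.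
rewrite /A eqxx mule1 => <-; congr (P' _); apply/seteqP; split => w /=.
  by move=> Bw; split => // k; case: eqP => // ->.
by move=> [_ _ /(_ j)]; rewrite eqxx.
Qed.

Let indep : mutually_independent P' (fun k : option ('I_p + 'I_q)%type =>
        match k with
        | None => sigma_of (fun w => ((X \o pr) w, (Y \o pr) w))
        | Some (inl i) => sigma_of (xi i)
        | Some (inr j) => sigma_of (eta j)
        end).
Proof.
move=> J A FA.
have [C mC AC] : exists2 C, measurable C &
    pr @^-1` C = if None \in J then A None else setT.
  case: ifPn => [/FA[B mB <-]|_]; last by exists setT.
  exists ((fun w => (X w, Y w)) @^-1` B); last by rewrite setTI.
  rewrite -[X in measurable X]setTI; apply: measurable_fun_pair => //.
have AI i : exists B : set R, measurable B /\
    xi i @^-1` B = if Some (inl i) \in J then A (Some (inl i)) else setT.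
  case: ifPn => [/FA[B mB <-]|_]; last by exists setT.
  by exists B; rewrite setTI.
have BI j : exists B : set R, measurable B /\
    eta j @^-1` B = if Some (inr j) \in J then A (Some (inr j)) else setT.
  case: ifPn => [/FA[B mB <-]|_]; last by exists setT.
  by exists B; rewrite setTI.
have [A' /all_and2[mA' AA']] := choice AI.
have [B' /all_and2[mB' AB']] := choice BI.
have -> : \bigcap_(i in [set i | i \in J]) A i =
    [set w : T' | [/\ C w.1, forall i, A' i (tnth w.2.1 i) &
                       forall j, B' j (tnth w.2.2 j)]].
  apply/seteqP; split => w /=.
    move=> h; split => [|i|j].
    - suff: (pr @^-1` C) w by []; rewrite AC; case: ifPn => // hJ; exact: h.
    - suff: (xi i @^-1` A' i) w by []; rewrite AA'.
      by case: ifPn => // hJ; exact: h.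
    - suff: (eta j @^-1` B' j) w by []; rewrite AB'.
      by case: ifPn => // hJ; exact: h.
  move=> [h0 h1 h2] [[i|j]|] /= hJ.
  - by have := AA' i; rewrite hJ => <-; exact: h1.
  - by have := AB' j; rewrite hJ => <-; exact: h2.
  - by move: AC; rewrite hJ => <-.
rewrite P'_box//.
rewrite [RHS]big_mkcond [RHS](bigD1 None)//=.
rewrite [X in _ = _ * X](reindex_omap Some id) => [|[]//].
rewrite [X in _ = _ * X]big_sumType/=; congr (_ * (_ * _)).
- by rewrite -prP// AC; case: ifP => // _; rewrite probability_setT.
- rewrite [RHS](eq_bigl xpredT) => [|i]; last by rewrite eqxx.
  apply: eq_bigr => i _; rewrite -(xiP i)// AA'.
  by case: ifP => // _; rewrite probability_setT.
- rewrite [RHS](eq_bigl xpredT) => [|j]; last by rewrite eqxx.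
  apply: eq_bigr => j _; rewrite -(etaP j)// AB'.
  by case: ifP => // _; rewrite probability_setT.
Qed.

Lemma gaussian_extension : exists (d' : measure_display)
    (T0 : measurableType d') (P0 : probability T0 R) (pr0 : {RV P0 >-> T})
    (xi0 : 'I_p -> {RV P0 >-> R}) (eta0 : 'I_q -> {RV P0 >-> R}),
  (forall A : set T, measurable A -> distribution P0 pr0 A = P A) /\
  gaussian_system P0 (X \o pr0) (Y \o pr0) xi0 eta0.
Proof.
pose prm : {RV P' >-> T} := HB.pack pr (isMeasurableFun.Build _ _ _ _ pr mpr).
pose xim i : {RV P' >-> R} :=
  HB.pack (xi i) (isMeasurableFun.Build _ _ _ _ (xi i) (mxi i)).
pose etam j : {RV P' >-> R} :=
  HB.pack (eta j) (isMeasurableFun.Build _ _ _ _ (eta j) (meta j)).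
exists _, T', P', prm, xim, etam; split; first exact: prP.
by split; [exact: mxi|exact: meta|exact: xiP|exact: etaP|exact: indep].
Qed.

End gaussian_extension.

(* Main.v *)
Require Import Defs.
From HB Require Import structures.
From mathcomp Require Import all_boot all_order all_algebra.
From mathcomp Require Import all_classical all_reals all_analysis.
From mathcomp Require Import complex measurable_realfun ring lra.

(* The key is a change of variables that trades a Gaussian direction and a
   radius for a point of R^n: if N is the standard Gaussian law on R^n and
   f >= 0, then
     int_0^oo (int f(r x) dN(x)) r^(-alpha-1) dr
       = K_n int f(t) |t|^(-n-alpha) dt,
   because the substitution t = r x turns the left-hand side into the integral
   of f(t) against int_0^oo (2 pi)^(-n/2) exp(-|t|^2/(2 r^2)) r^(-n-alpha-1) dr,
   which is a Gamma integral in v = |t|^2/(2 r^2).  The constants are such that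
   c_(alpha,n) = c_alpha K_n.  Since (X, Y) is independent of (xi, eta), the
   conditional expectations in dcov^H are almost surely the characteristic
   functions evaluated at r xi and s eta, where xi and eta, expanded in any
   orthonormal bases, are standard Gaussian vectors.  Applying the
   identity to s and then to r gives dcov^E. *)

Set Implicit Arguments.
Unset Strict Implicit.
Unset Printing Implicit Defensive.

Import Order.TTheory GRing.Theory Num.Theory.
Import numFieldNormedType.Exports.

Local Open Scope classical_set_scope.
Local Open Scope ring_scope.

(** No integrability is available, so every interchange of integrals is Tonelli's theorem for
    nonnegative functions with values in [0, +oo], and infinite values are carried through. Three
    points shape the proof. The orthonormal basis is first moved from [X] to [xi], so that it enters
    only through a linear isometry applied to a Gaussian vector; invariance of Lebesgue measure
    under this isometry is obtained without determinants, from translation invariance and a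
    rotation-invariant weight of mass 1. The conditional expectations are versions fixed by a
    choice, so they can be identified only almost surely, with means over [(X, Y)] in which the
    Gaussian vectors are frozen; they are treated through the real functions cos and sin, whose
    bound by 1 replaces moment conditions. Finally, the Gaussian variables live on an extension of
    the space on which dcov^E is computed, and the two spaces are linked only through the law of
    [(X, Y)]. *)

Local Notation Rn R n := (n.-tuple (measurableTypeR R)).
Local Notation N01 R :=
  (normal_prob (0 : R) 1 : probability (measurableTypeR R) R).
Local Notation gaussian R n :=
  (@power_measure _ (measurableTypeR R) R (N01 R) n).

(** * Integration against densities and powers of a measure *)

Section density.
Context d (T : measurableType d) (R : realType).
Variables mu nu : {measure set T -> \bar R}.
Variable rho : T -> R.
Hypothesis mrho : measurable_fun [set: T] rho.
Hypothesis rho0 : forall x, 0 <= rho x.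
Hypothesis nuE : forall A, measurable A ->
  nu A = (\int[mu]_(x in A) (rho x)%:E)%E.
Local Open Scope ereal_scope.
Import HBNNSimple.

Let density_nnsfun (h : {nnsfun T >-> R}) :
  \int[nu]_x (h x)%:E = \int[mu]_x ((h x)%:E * (rho x)%:E).
Proof.
under [LHS]eq_integral do rewrite fimfunE -fsumEFin//.
rewrite [LHS]ge0_integral_fsum//; last 2 first.
- by move=> r; exact/measurable_EFinP/measurableT_comp.
- by move=> n x _; rewrite EFinM nnfun_muleindic_ge0.
under [RHS]eq_integral.
  move=> x xD; rewrite muleC fimfunE -fsumEFin// ge0_mule_fsumr; last first.
    by move=> r; rewrite EFinM nnfun_muleindic_ge0.
  over.
have mr r : measurable_fun [set: T] (fun x => (rho x)%:E *
  (r * \1_(h @^-1` [set r]) x)%:E).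
  apply: emeasurable_funM; first exact/measurable_EFinP.
  exact/measurable_EFinP/measurableT_comp.
rewrite [RHS]ge0_integral_fsum//; last first.
  move=> r x _; apply: mule_ge0; first by rewrite lee_fin.
  by rewrite EFinM nnfun_muleindic_ge0.
apply: eq_fsbigr => r _; rewrite integralZl_indic_nnsfun//= integral_indic//
  setIT nuE//.
(* For negative [r] the level set of the nonnegative [h] is empty and both sides vanish; otherwise
   the sign allows [r] to be moved under the integral. *)
have [r0|r0] := leP 0%R r; last first.
  rewrite preimage_nnfun0//.
  rewrite integral_set0 mule0; apply/esym/integral0_eq => x _.
  by rewrite indic0 mulr0 mule0.
rewrite -ge0_integralZl//=; last 2 first.
- exact/measurable_EFinP/measurable_funTS.
- by move=> x _; rewrite lee_fin.
rewrite integral_mkcond epatch_indic; apply: eq_integral => x _ /=.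
by rewrite EFinM [RHS]muleA (muleC (rho x)%:E).
Qed.

Lemma ge0_integral_density (f : T -> \bar R) :
  measurable_fun setT f -> (forall x, 0 <= f x) ->
  \int[nu]_x f x = \int[mu]_x (f x * (rho x)%:E).
Proof.
move=> mf f0; pose f_ := nnsfun_approx measurableT mf.
have f_cvg x : (EFin \o f_ ^~ x) n @[n --> \oo] --> f x.
  exact: cvg_nnsfun_approx.
have f_nd x m n : (m <= n)%N -> (f_ m x)%:E <= (f_ n x)%:E.
  by move=> mn; rewrite lee_fin; exact/lefP/nd_nnsfun_approx.
have fE x : limn (fun n => (f_ n x)%:E) = f x by exact/cvg_lim/f_cvg.
have frhoE x : limn (fun n => (f_ n x)%:E * (rho x)%:E) = f x * (rho x)%:E.
  by apply/cvg_lim => //; apply: cvgeZr => //; exact: f_cvg.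
under eq_integral do rewrite -fE.
under [RHS]eq_integral do rewrite -frhoE.
rewrite !monotone_convergence//=.
- by apply: congr_lim; apply/funext => n; exact: density_nnsfun.
- by move=> n; apply: emeasurable_funM; exact/measurable_EFinP/measurable_funTS.
- by move=> n x _; rewrite mule_ge0// lee_fin.
- by move=> x _ m n mn; rewrite lee_wpmul2r// ?lee_fin//; exact: f_nd.
- by move=> n; exact/measurable_EFinP/measurable_funTS.
- by move=> n x _; rewrite lee_fin.
- by move=> x _ m n; exact: f_nd.
Qed.

End density.

Section power_measure_integral.
Context d (T : measurableType d) (R : realType).
Local Open Scope ereal_scope.

Lemma integral_power_measureS (mu : {sigma_finite_measure set T -> \bar R}) n
    (f : n.+1.-tuple T -> \bar R) :
  measurable_fun setT f -> (forall x, 0 <= f x) ->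
  \int[@power_measure _ T R mu n.+1]_t f t =
  \int[mu]_x \int[@power_measure _ T R mu n]_t f (consv (x, t)).
Proof.
move=> mf f0.
rewrite [LHS](@ge0_integral_pushforward _ _ _ _ _ _ (@measurable_consv _ T n)
  (mu \x @power_measure _ T R mu n) setT f)//.
rewrite preimage_setT fubini_tonelli1 => [//||x]; last exact: f0.
apply: measurableT_comp => //; exact: measurable_consv.
Qed.

Lemma integral_power_measure0 (mu : {sigma_finite_measure set T -> \bar R})
    (f : 0.-tuple T -> \bar R) :
  measurable_fun setT f -> \int[@power_measure _ T R mu 0]_t f t = f [tuple].
Proof. by move=> mf; rewrite [LHS]integral_dirac// diracT mul1e. Qed.

(** The map may vary with the coordinate because a translation shifts each coordinate by its own
    amount. It is used with [k] = 1 for translations and with [k] = 1/|c| for dilations. *)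
Lemma integral_power_measure_map (mu : {sigma_finite_measure set T -> \bar R})
    n (phi : 'I_n -> T -> T) (k : R) : (0 <= k)%R ->
  (forall i, measurable_fun setT (phi i)) ->
  (forall i f, measurable_fun setT f -> (forall x, 0 <= f x) ->
    \int[mu]_x f (phi i x) = k%:E * \int[mu]_x f x) ->
  forall f : n.-tuple T -> \bar R, measurable_fun setT f ->
    (forall x, 0 <= f x) ->
  \int[@power_measure _ T R mu n]_t f [tuple phi i (tnth t i) | i < n] =
  (k ^+ n)%:E * \int[@power_measure _ T R mu n]_t f t.
Proof.
move=> k0; elim: n phi => [|n IH] phi mphi phiE f mf f0.
  rewrite !integral_power_measure0//.
    by rewrite expr0 mul1e tuple0.
  by apply: measurableT_comp => //; apply/measurable_fun_tnthP => -[].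
have mtup m (psi : 'I_m -> T -> T) : (forall i, measurable_fun setT (psi i)) ->
    measurable_fun setT (fun t : m.-tuple T => [tuple psi i
      (tnth t i) | i < m]).
  move=> mpsi; apply/measurable_fun_tnthP => i.
  rewrite (_ : _ \o _ = psi i \o (@tnth m T ^~ i)).
    by apply: measurableT_comp => //; exact: measurable_tnth.
  by apply/funext => t /=; rewrite tnth_mktuple.
rewrite !integral_power_measureS//; last by apply: measurableT_comp => //;
  exact: mtup.
pose F x := \int[@power_measure _ T R mu n]_t f (consv (x, t)).
have mfc : measurable_fun setT (f \o @consv _ T n).
  by apply: measurableT_comp => //; exact: measurable_consv.
transitivity (\int[mu]_x ((k ^+ n)%:E * F (phi ord0 x))).
  apply: eq_integral => x _.
  rewrite -(IH (fun i => phi (lift ord0 i)) (fun i => mphi _) (fun i => phiE _)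
    (fun t => f (consv (phi ord0 x, t))))//.
  - apply: eq_integral => t _; congr (f _); apply/eq_from_tnth => i.
    rewrite tnth_mktuple; case: (unliftP ord0 i) => [j ->|->].
      by rewrite /consv !tnthS/= tnth_mktuple.
    by rewrite !tnth0.
  - exact: (@measurable_fun_pair2 _ _ _ _ _ _ (f \o @consv _ T n) _ mfc).
have mF : measurable_fun setT F.
  exact: (measurable_fun_fubini_tonelli_F (m2 := @power_measure _ T R mu n)
    (f \o @consv _ T n) mfc (fun=> f0 _)).
rewrite ge0_integralZl_EFin; last 4 first.
- exact: measurableT.
- by move=> x _; exact: integral_ge0.
- by apply: (@measurableT_comp _ _ _ _ _ _ F).
- exact: exprn_ge0.
rewrite phiE//.
- by rewrite muleA -EFinM exprSr.
- by move=> x; exact: integral_ge0.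
Qed.

(** The density is assumed through its integrals rather than its values on sets, which is the form
    that the induction applies to the first coordinate. *)
Lemma integral_power_measure_density
    (mu nu : {sigma_finite_measure set T -> \bar R}) (rho : T -> R) :
  measurable_fun setT rho -> (forall x, 0 <= rho x)%R ->
  (forall f, measurable_fun setT f -> (forall x, 0 <= f x) ->
    \int[nu]_x f x = \int[mu]_x (f x * (rho x)%:E)) ->
  forall n (f : n.-tuple T -> \bar R),
  measurable_fun setT f -> (forall x, 0 <= f x) ->
  \int[@power_measure _ T R nu n]_t f t =
  \int[@power_measure _ T R mu n]_t (f t * (\prod_(i < n) rho (tnth t i))%:E).
Proof.
move=> mrho rho0 nuE; elim => [|n IH] f mf f0.
  rewrite !integral_power_measure0//; first by rewrite big_ord0 mule1.
  by under eq_fun do rewrite big_ord0 mule1.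
have mfc : measurable_fun setT (f \o @consv _ T n).
  by apply: measurableT_comp => //; exact: measurable_consv.
have mprod m : measurable_fun [set: m.-tuple T]
    (fun t : m.-tuple T => \prod_(i < m) rho (tnth t i))%R.
  apply: measurable_prod => i _.
  by apply: measurableT_comp => //; exact: measurable_tnth.
rewrite !integral_power_measureS//; last 2 first.
- by apply: emeasurable_funM => //; apply/measurable_EFinP; exact: mprod.
- by move=> t; rewrite mule_ge0// lee_fin prodr_ge0.
rewrite nuE//; last 2 first.
- exact: (measurable_fun_fubini_tonelli_F (m2 := @power_measure _ T R nu n)
    (f \o @consv _ T n) mfc (fun=> f0 _)).
- by move=> x; exact: integral_ge0.
have mfx x : measurable_fun setT (fun t => f (consv (x, t))).
  exact: (@measurable_fun_pair2 _ _ _ _ _ _ (f \o @consv _ T n) _ mfc).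
apply: eq_integral => x _; rewrite IH//.
rewrite muleC -ge0_integralZl_EFin//.
- apply: eq_integral => t _; rewrite muleCA -EFinM big_ord_recl; congr (_ * _).
  by congr EFin; congr (_ * _)%R; apply: eq_bigr => i _; rewrite /consv tnthS.
- by move=> t _; rewrite mule_ge0// lee_fin prodr_ge0.
- by apply: emeasurable_funM => //; apply/measurable_EFinP; exact: mprod.
Qed.

End power_measure_integral.

(** * Lebesgue measure on R^n *)

Section lebesgue_measure_affine.
Context {R : realType}.
Local Notation mu := (@lebesgue_measure R).
Local Open Scope ereal_scope.

(** The image of [mu] under [phi], divided by [k], agrees with [mu] on half-open intervals, hence
    everywhere by uniqueness of Lebesgue measure. *)
Let integral_pushforward_affine (phi : R -> R) (k : R) : (0 < k)%R ->
  measurable_fun [set: R] phi ->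
  (forall a b : R, mu (phi @^-1` `]a, b]) = k%:E * mu `]a, b]) ->
  forall f : R -> \bar R, measurable_fun [set: R] f -> (forall x, 0 <= f x) ->
  \int[mu]_x f (phi x) = k%:E * \int[mu]_x f x.
Proof.
move=> k0 mphi phiE f mf f0.
have k1 : (0 <= k^-1)%R by rewrite invr_ge0 ltW.
pose phi' : measurableTypeR R -> measurableTypeR R := phi.
have mphi' : measurable_fun setT phi' by exact: mphi.
pose nu := pushforward mu phi'.
pose nu' := measure_function_pushforward__canonical__measure_function_Measure
  mu mphi'.
have nuE A : measurable A -> mu A = mscale (NngNum k1) nu' A.
  apply: lebesgue_measure_unique => _ [[a b] /= _ <-].
  by rewrite /mscale/= /pushforward phiE muleA -EFinM mulVf ?gt_eqF// mul1e.
rewrite [X in _ = _ * X](eq_measure_integral (mscale (NngNum k1) nu'));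
  last first.
  by move=> A mA _; exact: nuE.
rewrite ge0_integral_mscale//= muleA -EFinM divff ?gt_eqF// mul1e.
by rewrite ge0_integral_pushforward.
Qed.

Lemma ge0_integral_lebesgueD (c : R) (f : R -> \bar R) :
  measurable_fun [set: R] f -> (forall x, 0 <= f x) ->
  \int[mu]_x f (x + c)%R = \int[mu]_x f x.
Proof.
move=> mf f0; rewrite -[RHS]mul1e.
apply: (integral_pushforward_affine (phi := +%R^~ c)) => //.
  exact: measurable_funD.
move=> a b; rewrite mul1e.
rewrite (_ : _ @^-1` _ = `]a - c, b - c]%classic)%R.
  rewrite !lebesgue_measure_itv/= !lte_fin ltrD2r.
  by case: ifPn => // _; rewrite -?EFinB; congr EFin; ring.
by apply/seteqP; split => x /=; rewrite !in_itv/= ltrBlDr lerBrDr.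
Qed.

Lemma ge0_integral_lebesgueM (c : R) (f : R -> \bar R) : c != 0%R ->
  measurable_fun [set: R] f -> (forall x, 0 <= f x) ->
  \int[mu]_x f (c * x)%R = `|c|^-1%:E * \int[mu]_x f x.
Proof.
move=> c0 mf f0.
apply: (integral_pushforward_affine (phi := *%R c)) => //=.
- by rewrite invr_gt0 normr_gt0.
move=> a b.
have [c_lt0|c_gt0|/eqP] := ltgtP c 0%R; last by rewrite (negbTE c0).
(* A negative factor reverses the interval, so the preimage is closed on the left and open on the
   right. *)
- rewrite (_ : _ @^-1` _ = `[b / c, a / c[%classic)%R.
    rewrite !lebesgue_measure_itv/= !lte_fin ltr_nM2r ?invr_lt0//.
    rewrite ltr0_norm//; case: ifPn => _; last by rewrite mule0.
    by rewrite -!EFinB -EFinM; congr EFin; field.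
  by apply/seteqP; split => x /=; rewrite !in_itv/= ltr_ndivlMr// ler_ndivrMr//
    (mulrC x) andbC.
- rewrite (_ : _ @^-1` _ = `]a / c, b / c]%classic)%R.
    rewrite !lebesgue_measure_itv/= !lte_fin ltr_pM2r ?invr_gt0//.
    rewrite gtr0_norm//; case: ifPn => _; last by rewrite mule0.
    by rewrite -!EFinB -EFinM; congr EFin; field.
  by apply/seteqP; split => x /=; rewrite !in_itv/= ltr_pdivrMr// ler_pdivlMr//
    (mulrC x).
Qed.

End lebesgue_measure_affine.


Section vector_operations.
Context {R : realType} {n : nat}.
Implicit Types x y : n.-tuple R.

Definition addv x y : n.-tuple R := [tuple tnth x i + tnth y i | i < n].

Definition scalev (c : R) x : n.-tuple R := [tuple c * tnth x i | i < n].

(** The linear map that sends the standard basis to the family [e]. *)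
Definition lincomb (e : 'I_n -> n.-tuple R) x : n.-tuple R :=
  [tuple \sum_(i < n) tnth x i * tnth (e i) k | k < n].

(** Exchanging the two sums moves the basis from [x] to [xi]: the Gaussian vector is rotated and the
    random vector stays as it is. *)
Lemma basis_dotE e (xi : 'I_n -> R) x :
  basis_dot e xi x = dotv (lincomb e [tuple xi i | i < n]) x.
Proof.
rewrite /basis_dot /dotv; under eq_bigr do rewrite mulr_suml.
rewrite exchange_big/=; apply: eq_bigr => k _.
rewrite tnth_mktuple mulr_suml; apply: eq_bigr => i _.
by rewrite tnth_mktuple; ring.
Qed.

Lemma dotv_scalel c x y : dotv (scalev c x) y = c * dotv x y.
Proof.
by rewrite /dotv mulr_sumr; apply: eq_bigr => i _; rewrite tnth_mktuple mulrA.
Qed.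

Lemma dotv_scaler c x y : dotv x (scalev c y) = c * dotv x y.
Proof.
rewrite /dotv mulr_sumr; apply: eq_bigr => i _.
by rewrite tnth_mktuple mulrCA.
Qed.

Lemma dotv_lincomb e x : orthonormal_basis e ->
  dotv (lincomb e x) (lincomb e x) = dotv x x.
Proof.
move=> [e_orth _]; rewrite /dotv.
transitivity (\sum_(i < n) \sum_(j < n) tnth x i * tnth x j * dotv (e i) (e j)).
  under eq_bigr => k _.
    rewrite !tnth_mktuple mulr_suml.
    under eq_bigr do rewrite mulr_sumr.
    over.
  rewrite exchange_big/=; apply: eq_bigr => i _.
  rewrite exchange_big/=; apply: eq_bigr => j _.
  by rewrite /dotv mulr_sumr; apply: eq_bigr => k _; ring.
apply: eq_bigr => i _; rewrite (bigD1 i)//= e_orth eqxx mulr1 big1 ?addr0// =>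
  j ji.
by rewrite e_orth eq_sym (negbTE ji) mulr0.
Qed.

(** [y'] is the coordinate vector of [y] in the basis, so the spanning half of [orthonormal_basis]
    enters here. This is the only form of surjectivity that the invariance argument asks for. *)
Lemma lincomb_translate e y : orthonormal_basis e ->
  exists y', forall x, lincomb e (addv x y') = addv (lincomb e x) y.
Proof.
move=> [_ /(_ y)[c yE]]; exists [tuple c i | i < n] => x.
apply/eq_from_tnth => k; rewrite !tnth_mktuple yE -big_split/=.
by apply: eq_bigr => i _; rewrite !tnth_mktuple mulrDl.
Qed.

Lemma addvC x y : addv x y = addv y x.
Proof. by apply/eq_from_tnth => k; rewrite !tnth_mktuple addrC. Qed.

Lemma addvN x y : addv (addv x y) (scalev (-1) y) = x.
Proof. by apply/eq_from_tnth => k; rewrite !tnth_mktuple mulN1r addrK. Qed.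

End vector_operations.

Section measurable_vector_operations.
Context d (T : measurableType d) {R : realType} {n : nat}.

Lemma measurable_addv (f g : T -> Rn R n) :
  measurable_fun setT f -> measurable_fun setT g ->
  measurable_fun setT (fun w => addv (f w) (g w) : Rn R n).
Proof.
move=> /measurable_fun_tnthP mf /measurable_fun_tnthP mg.
apply/measurable_fun_tnthP => i.
rewrite (_ : _ \o _ = fun w => tnth (f w) i + tnth (g w) i).
  exact: (measurable_funD (mf i) (mg i)).
by apply/funext => w /=; rewrite tnth_mktuple.
Qed.

Lemma measurable_scalev (c : T -> R) (f : T -> Rn R n) :
  measurable_fun setT c -> measurable_fun setT f ->
  measurable_fun setT (fun w => scalev (c w) (f w) : Rn R n).
Proof.
move=> mc /measurable_fun_tnthP mf.
apply/measurable_fun_tnthP => i.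
rewrite (_ : _ \o _ = fun w => c w * tnth (f w) i).
  exact: (measurable_funM mc (mf i)).
by apply/funext => w /=; rewrite tnth_mktuple.
Qed.

Lemma measurable_lincomb e (f : T -> Rn R n) :
  measurable_fun setT f -> measurable_fun setT (fun w => lincomb e
    (f w) : Rn R n).
Proof.
move=> /measurable_fun_tnthP mf.
apply/measurable_fun_tnthP => k.
rewrite (_ : _ \o _ = fun w => \sum_(i < n) tnth (f w) i * tnth (e i) k).
  apply: measurable_sum => i.
  exact: (measurable_funM (mf i) (measurable_cst _)).
by apply/funext => w /=; rewrite tnth_mktuple.
Qed.

Lemma measurable_dotv (f g : T -> Rn R n) :
  measurable_fun setT f -> measurable_fun setT g ->
  measurable_fun setT (fun w => dotv (f w) (g w)).
Proof.
move=> /measurable_fun_tnthP mf /measurable_fun_tnthP mg.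
by apply: measurable_sum => i; exact: (measurable_funM (mf i) (mg i)).
Qed.

End measurable_vector_operations.

Section lebesgue_measuren_invariance.
Context {R : realType} {n : nat}.
Local Notation mu := (@lebesgue_measuren R n).
Local Open Scope ereal_scope.
Implicit Types f g : Rn R n -> \bar R.

Lemma ge0_integral_lebesguen_addv (c : Rn R n) f :
  measurable_fun setT f -> (forall x, 0 <= f x) ->
  \int[mu]_t f (addv t c) = \int[mu]_t f t.
Proof.
move=> mf f0; rewrite -[RHS]mul1e -(expr1n _ n).
apply: (integral_power_measure_map (mu := lebesgue_measure)
  (phi := fun i (x : measurableTypeR R) => (x + tnth c i)%R)) => //.
  move=> i.
  have : measurable_fun [set: R] (+%R^~ (tnth c i)) by exact: measurable_funD.
  exact.
by move=> i h mh h0; rewrite mul1e; exact: ge0_integral_lebesgueD.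
Qed.

Lemma ge0_integral_lebesguen_scalev (c : R) f : c != 0%R ->
  measurable_fun setT f -> (forall x, 0 <= f x) ->
  \int[mu]_t f (scalev c t) = (`|c|^-1 ^+ n)%:E * \int[mu]_t f t.
Proof.
move=> c0 mf f0.
apply: (integral_power_measure_map (mu := lebesgue_measure)
  (phi := fun i (x : measurableTypeR R) => (c * x)%R)) => //.
  by move=> i; exact: mulrl_measurable.
by move=> i h mh h0; exact: ge0_integral_lebesgueM.
Qed.

(* Weil's argument for the uniqueness of Haar measure, with an invariant
   weight [w]: both sides equal the double integral of w(O x) g(y + O x). *)
Lemma ge0_integral_lebesguen_isometry (O : Rn R n -> Rn R n)
    (w : Rn R n -> \bar R) g :
  measurable_fun setT O ->
  (forall y, exists y', forall x, O (addv x y') = addv (O x) y) ->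
  measurable_fun setT w -> (forall x, 0 <= w x) ->
  (forall x, w (O x) = w x) -> \int[mu]_x w x = 1 ->
  measurable_fun setT g -> (forall x, 0 <= g x) ->
  \int[mu]_x g (O x) = \int[mu]_x g x.
Proof.
move=> mO O_add mw w0 wO w1 mg g0.
have N1 : (-1 != 0 :> R)%R by rewrite oppr_eq0 oner_eq0.
have mOT : measurable_fun setT (fun z : Rn R n * Rn R n => O z.1).
  exact: measurableT_comp.
have mOT2 : measurable_fun setT (fun z : Rn R n * Rn R n => O z.2).
  exact: measurableT_comp.
(* For fixed [x] the inserted factor w(O x - y) has integral 1 in [y], by reflection and translation
   invariance. *)
transitivity (\int[mu]_x \int[mu]_y (w (addv (O x) (scalev (-1) y)) * g (O x))).
  apply: eq_integral => x _.
  have mwx : measurable_fun setT (fun y : Rn R n => w (addv (O x) y)).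
    by apply: measurableT_comp => //; exact: measurable_addv.
  have mwxN : measurable_fun setT (fun y : Rn R n => w (addv (O x) (scalev
    (-1) y))).
    apply: measurableT_comp => //; apply: measurable_addv => //.
    exact: measurable_scalev.
  rewrite ge0_integralZr//.
  rewrite (ge0_integral_lebesguen_scalev (f := fun y => w (addv (O x) y)) N1)//.
  rewrite normrN normr1 invr1 expr1n mul1e.
  under eq_integral do rewrite addvC.
  by rewrite ge0_integral_lebesguen_addv// w1 mul1e.
rewrite (fubini_tonelli (m1 := mu) (m2 := mu)
  (fun z => w (addv (O z.1) (scalev (-1) z.2)) * g (O z.1)))/=; last 2 first.
- apply: emeasurable_funM; last exact: measurableT_comp.
  apply: measurableT_comp => //; apply: measurable_addv => //.
  exact: measurable_scalev.
- by move=> z; rewrite mule_ge0.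
(* For fixed [y], translating [x] by the [y'] of [O_add] adds [y] to O x, which cancels the shift
   inside [w] and moves it into [g]. *)
transitivity (\int[mu]_y \int[mu]_x (w (O x) * g (addv (O x) y))).
  apply: eq_integral => y _.
  have [y' Oy'] := O_add y.
  rewrite -(ge0_integral_lebesguen_addv y'
    (f := fun x => w (addv (O x) (scalev (-1) y)) * g (O x))).
  - by apply: eq_integral => x _; rewrite Oy' addvN.
  - apply: emeasurable_funM; last exact: measurableT_comp.
    by apply: measurableT_comp => //; exact: measurable_addv.
  - by move=> x; rewrite mule_ge0.
rewrite -(fubini_tonelli (m1 := mu) (m2 := mu)
  (fun z => w (O z.1) * g (addv (O z.1) z.2)))/=; last 2 first.
- apply: emeasurable_funM; first exact: measurableT_comp.
  by apply: measurableT_comp => //; exact: measurable_addv.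
- by move=> z; rewrite mule_ge0.
transitivity (\int[mu]_x (w x * \int[mu]_y g y)).
  apply: eq_integral => x _.
  rewrite ge0_integralZl//; last first.
    by apply: measurableT_comp => //; exact: measurable_addv.
  under eq_integral do rewrite addvC.
  by rewrite ge0_integral_lebesguen_addv// wO.
by rewrite ge0_integralZr// ?w1 ?mul1e//; exact: integral_ge0.
Qed.

End lebesgue_measuren_invariance.

(** * The radial integral *)

Section inverse_gamma_integral.
Context {R : realType}.
Local Notation mu := (@lebesgue_measure R).

(** With u = x / a, the inequality u <= 1 + u <= exp(u) raised to the power [a] gives the bound. *)
Lemma powR_expRN_le (a x : R) : 0 <= a -> 0 <= x ->
  x `^ a * expR (- x) <= a `^ a.
Proof.
move=> a0 x0; have [->|an0] := eqVneq a 0.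
  by rewrite !powRr0 mul1r -[leRHS]expR0 ler_expR oppr_le0.
have {an0}a0 : 0 < a by rewrite lt_neqAle eq_sym an0.
rewrite expRN ler_pdivrMr ?expR_gt0//.
rewrite -[in leLHS](divfK (lt0r_neq0 a0) x) mulrC powRM ?divr_ge0 ?(ltW a0)//.
rewrite ler_pM2l ?powR_gt0//.
rewrite -[in leRHS](divfK (lt0r_neq0 a0) x) expRM.
apply: ge0_ler_powR; rewrite ?nnegrE ?divr_ge0 ?expR_ge0 ?(ltW a0)//.
by apply: le_trans (expR_ge1Dx _); rewrite lerDr.
Qed.

(* The inverse-gamma density, up to normalization. *)
Definition inv_gamma_fun (m c s : R) : R :=
  expR (- (s `^ (- 2) * c ^+ 2 / 2)) * s `^ (- (m + 1)).

Lemma inv_gamma_fun_ge0 m c s : 0 <= inv_gamma_fun m c s.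
Proof. by rewrite mulr_ge0 ?expR_ge0 ?powR_ge0. Qed.

Lemma measurable_inv_gamma_fun m c : measurable_fun [set: R]
  (inv_gamma_fun m c).
Proof.
apply: measurable_funM; last exact: measurable_powR.
apply: measurableT_comp => //; apply: measurableT_comp => //.
apply: measurable_funM => //; apply: measurable_funM => //;
  exact: measurable_powR.
Qed.

(** With x = s^-2 / 2, a power s^(-2b) equals 2^b x^b, so exp(-x) s^(-2b) is at most 2^b b^b. The
    two summands of the constant come from 1 + s^2: b = (m + 1) / 2 for the term 1 and b = (m - 1) /
    2, nonnegative because m >= 1, for the term s^2. *)
Lemma inv_gamma_fun_le m s : 1 <= m -> 0 < s ->
  inv_gamma_fun m 1 s <=
  (2 `^ ((m + 1) / 2) * ((m + 1) / 2) `^ ((m + 1) / 2) +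
   2 `^ ((m - 1) / 2) * ((m - 1) / 2) `^ ((m - 1) / 2)) * (oneDsqr s)^-1.
Proof.
move=> m1 s0; rewrite ler_pdivlMr ?oneDsqr_gt0//.
rewrite /oneDsqr mulrDr mulr1 /inv_gamma_fun expr1n mulr1.
set x := s `^ (- 2) / 2.
have x0 : 0 <= x by rewrite divr_ge0 ?powR_ge0.
have sE b : s `^ (- (b * 2)) = 2 `^ b * x `^ b.
  rewrite -powRM// /x (mulrC 2) divfK// -powRrM; congr (_ `^ _); ring.
have bound b : 0 <= b -> expR (- x) * s `^ (- (b * 2)) <= 2 `^ b * b `^ b.
  move=> b0; rewrite sE mulrCA ler_pM2l ?powR_gt0// mulrC.
  exact: powR_expRN_le.
apply: lerD.
  rewrite (_ : - (m + 1) = - ((m + 1) / 2 * 2)); last by field.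
  by apply: bound; lra.
rewrite -mulrA -(powR_mulrn 2 (ltW s0)) -powRD; last first.
  by apply/implyP => _; rewrite gt_eqF.
rewrite (_ : - (m + 1) + 2 = - ((m - 1) / 2 * 2)); last by field.
by apply: bound; lra.
Qed.

(** Finiteness matters because [Gamma] is a real-valued integral, in which an infinite value would
    be read as 0. *)
Lemma integral_inv_gamma_fun_lty (m : R) : 1 <= m ->
  (\int[mu]_(s in `]0%R, +oo[) (inv_gamma_fun m 1 s)%:E < +oo)%E.
Proof.
move=> m1; set C := 2 `^ ((m + 1) / 2) * ((m + 1) / 2) `^ ((m + 1) / 2) +
   2 `^ ((m - 1) / 2) * ((m - 1) / 2) `^ ((m - 1) / 2).
have C0 : 0 <= C by rewrite addr_ge0// mulr_ge0 ?powR_ge0.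
apply: (@le_lt_trans _ _ (\int[mu]_(s in `]0%R, +oo[) (C%:E *
  ((oneDsqr s)^-1)%:E))%E).
  apply: ge0_le_integral => //.
  - by move=> x _; rewrite lee_fin inv_gamma_fun_ge0.
  - by apply/measurable_EFinP/measurable_funTS; exact: measurable_inv_gamma_fun.
  - apply/measurable_EFinP/measurable_funTS/measurable_funM => //.
    by apply: continuous_measurable_fun; exact: continuous_oneDsqrV.
  - move=> x /=; rewrite in_itv/= andbT => x0.
    by rewrite -EFinM lee_fin; exact: inv_gamma_fun_le.
have mone : measurable_fun [set: R] (fun s : R => (oneDsqr s)^-1).
  by apply: continuous_measurable_fun; exact: continuous_oneDsqrV.
rewrite ge0_integralZl//; last first.
  exact/measurable_EFinP/measurable_funTS.
rewrite lte_mul_pinfty ?lee_fin//.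
apply: (@le_lt_trans _ _ (\int[mu]_(s in `[0%R, +oo[) ((oneDsqr s)^-1)%:E)%E).
  apply: ge0_subset_integral => //.
  - exact/measurable_EFinP/measurable_funTS.
  - by apply: subset_itvr; rewrite bnd_simp.
by rewrite integral0y_oneDsqr ltry.
Qed.

(** Dilate [s] by [c]: the exponential becomes that of parameter 1, the power of [s] yields
    c^(-m-1), and the Jacobian restores one factor [c]. *)
Lemma integral_inv_gamma_funE (m c : R) : 0 < c ->
  (\int[mu]_(s in `]0%R, +oo[) (inv_gamma_fun m c s)%:E =
   (c `^ (- m))%:E * \int[mu]_(s in `]0%R, +oo[) (inv_gamma_fun m 1 s)%:E)%E.
Proof.
move=> c0; pose D : set R := `]0%R, +oo[%classic.
pose g b : R -> \bar R := (EFin \o inv_gamma_fun m b) \_ D.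
have mD : measurable D by exact: measurable_itv.
have mg b : measurable_fun [set: R] (g b).
  apply/(measurable_restrictT _ mD).
  by apply/measurable_EFinP/measurable_funTS; exact: measurable_inv_gamma_fun.
have g0 b x : (0 <= g b x)%E.
  by apply: erestrict_ge0 => y _; rewrite lee_fin inv_gamma_fun_ge0.
have gE b : (\int[mu]_(s in `]0%R, +oo[) (inv_gamma_fun m b s)%:E =
  \int[mu]_s g b s)%E.
  by rewrite integral_mkcond.
have := ge0_integral_lebesgueM (lt0r_neq0 c0) (mg c) (g0 c).
rewrite gtr0_norm// => /(congr1 (fun x => c%:E * x)%E).
rewrite [X in _ = X -> _]muleA -EFinM divff ?gt_eqF// mul1e !gE => <-.
have mgc : measurable_fun [set: R] (fun x => g c (c * x)).
  apply: (measurableT_comp (mg c)); exact: mulrl_measurable.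
rewrite -ge0_integralZl_EFin; last 4 first.
- exact: measurableT.
- by move=> s _; exact: g0.
- exact: mgc.
- exact: ltW.
rewrite -[RHS]ge0_integralZl_EFin; last 4 first.
- exact: measurableT.
- by move=> s _; exact: g0.
- exact: mg.
- exact: powR_ge0.
apply: eq_integral => s _; rewrite /g !patchE.
have -> : (c * s \in D) = (s \in D).
  by apply/idP/idP; rewrite /D !inE/= !in_itv/= !andbT pmulr_rgt0.
case: ifPn => sD; last by rewrite !mule0.
have s0 : 0 < s by move: sD; rewrite /D inE/= in_itv/= andbT.
rewrite -!EFinM; congr EFin; rewrite /inv_gamma_fun expr1n mulr1.
have -> : (c * s) `^ (- 2) * c ^+ 2 = s `^ (- 2).
  rewrite powRM ?(ltW c0) ?(ltW s0)// mulrAC -(powR_mulrn 2 (ltW c0)) -powRD.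
    by rewrite addNr powRr0 mul1r.
  by rewrite (gt_eqF c0) implybT.
rewrite powRM ?(ltW c0) ?(ltW s0)// mulrCA [RHS]mulrCA; congr (_ * _).
rewrite mulrA -[X in X * _ * _](powRr1 (ltW c0)) -powRD.
  by congr (_ `^ _ * _); ring.
by rewrite (gt_eqF c0) implybT.
Qed.

Lemma continuous_powR_gt0 (r x : R) : 0 < x ->
  {for x, continuous (@powR R ^~ r)}.
Proof.
move=> x0; apply/differentiable_continuous/derivable1_diffP.
by have [] := is_derive1_powR r x0.
Qed.

Section half_inverse_square.
Let F (s : R) : R := s `^ (- 2) / 2.

Let FE s : 0 < s -> F s = (s ^+ 2 * 2)^-1.
Proof. by move=> s0; rewrite /F (powR_invn 2 (ltW s0)) [RHS]invfM. Qed.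

Let F_gt0 s : 0 < s -> 0 < F s.
Proof. by move=> s0; rewrite divr_gt0// powR_gt0. Qed.

Let F_decr x y : 0 < x -> x < y -> F y < F x.
Proof.
move=> x0 xy; have y0 := lt_trans x0 xy.
by rewrite !FE// ltf_pV2 ?posrE ?mulr_gt0 ?exprn_gt0// ltr_pM2r// ltr_pXn2r
  ?nnegrE ?ltW.
Qed.

Let F_nincr x y : 0 < x -> x <= y -> F y <= F x.
Proof. by move=> x0; rewrite le_eqVlt => /predU1P[->//|/(F_decr x0)/ltW]. Qed.

Let dF (s : R) : 0 < s -> is_derive s (1 : R) F (- s `^ (- 3)).
Proof.
move=> s0; have H := is_derive1_powR (- 2) s0.
rewrite (_ : F = 2^-1 \*: (@powR R ^~ (- 2))); last first.
  by apply/funext => x; exact: mulrC.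
apply: (is_derive_eq (is_deriveZ 2^-1 H)).
rewrite (_ : - 2 - 1 = - 3); last by ring.
by rewrite /GRing.scale/=; field.
Qed.

Let F'E s : 0 < s -> derive1 F s = - s `^ (- 3).
Proof. by move=> s0; rewrite derive1E;
  exact: (@derive_val _ _ _ _ _ _ _ (dF s0)). Qed.

Let cF' x : 0 < x -> {for x, continuous (derive1 F)}.
Proof.
move=> x0; rewrite /prop_for /continuous_at (F'E x0).
have /cvgN := @continuous_powR_gt0 (- 3) x x0.
apply: cvg_trans; apply: near_eq_cvg; near=> z.
rewrite F'E//.
by near: z; exact: lt_nbhsr.
Unshelve. all: end_near. Qed.

Let cF x : 0 < x -> {for x, continuous F}.
Proof.
move=> x0; apply/differentiable_continuous/derivable1_diffP.
by have [] := dF x0.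
Qed.

Let integral_substF (G : R -> R) a b : 0 < a -> a < b ->
  (forall x, 0 < x -> {for x, continuous G}) ->
  (\int[mu]_(v in `[F b, F a]) (G v)%:E =
   \int[mu]_(s in `[a, b]) (G (F s) * s `^ (- 3))%:E)%E.
Proof.
move=> a0 ab cG; have b0 := lt_trans a0 ab.
rewrite integration_by_substitution_decreasing.
- apply: eq_integral => s; rewrite inE/= in_itv/= =>
    /andP[/(lt_le_trans a0) s0 _].
  by rewrite !fctE F'E// opprK.
- exact: ltW.
- move=> x y; rewrite !in_itv/= => _ /andP[/(lt_le_trans a0) y0 _] yx.
  exact: F_decr.
- by move=> x; rewrite in_itv/= => /andP[/(lt_trans a0) x0 _]; exact: cF'.
- by apply/cvg_ex; exists ((derive1 F) a); exact/cvg_at_right_filter/cF'.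
- by apply/cvg_ex; exists ((derive1 F) b); exact/cvg_at_left_filter/cF'.
- split.
  + by move=> x; rewrite in_itv/= => /andP[/(lt_trans a0) x0 _];
      have [] := dF x0.
  + exact/cvg_at_right_filter/cF.
  + exact/cvg_at_left_filter/cF.
- apply: continuous_in_subspaceT => x; rewrite inE/= in_itv/= => /andP[Fbx _].
  by apply: cG; exact: lt_le_trans (F_gt0 b0) Fbx.
Qed.

Let bigcup_itv (a b : R^nat) :
  (forall n, 0 < a n) -> {homo a : m n / (m <= n)%N >-> n <= m} ->
  {homo b : m n / (m <= n)%N >-> m <= n} ->
  (forall x, 0 < x -> exists n, a n <= x <= b n) ->
  \bigcup_n `[a n, b n]%classic = `]0, +oo[%classic.
Proof.
move=> a0 da nb ab; apply/seteqP; split => x /=.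
  by move=> [n _ /=]; rewrite !in_itv/= => /andP[/(lt_le_trans (a0 n)) -> _].
by rewrite in_itv/= andbT => /ab[n abn]; exists n => //=; rewrite in_itv.
Qed.

(** The decreasing substitution v = s^-2 / 2, of derivative -s^-3, is performed on compact intervals
    and passes to the half-line by monotone convergence. Continuity is asked only away from 0, since
    v^(m/2 - 1) blows up at 0 for m < 2. *)
Lemma ge0_integral_half_inverse_square (G : R -> R) :
  measurable_fun [set: R] G -> (forall x, 0 <= G x) ->
  (forall x, 0 < x -> {for x, continuous G}) ->
  (\int[mu]_(v in `]0%R, +oo[) (G v)%:E =
   \int[mu]_(s in `]0%R, +oo[) (G (s `^ (- 2) / 2) * s `^ (- 3))%:E)%E.
Proof.
(* The shift by 2 makes [a n < b n] strict already for n = 0, as [integral_substF] requires. *)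
move=> mG G0 cG; pose a n : R := n.+2%:R^-1; pose b n : R := n.+2%:R.
have a0 n : 0 < a n by rewrite invr_gt0.
have b0 n : 0 < b n by [].
have da : {homo a : m n / (m <= n)%N >-> n <= m}.
  by move=> m n mn; rewrite /a lef_pV2 ?posrE// ler_nat.
have nb : {homo b : m n / (m <= n)%N >-> m <= n}.
  by move=> m n mn; rewrite /b ler_nat.
have ab n : a n < b n.
  by apply: (@lt_trans _ _ 1); rewrite ?invf_lt1 ?ltr1n.
have abx x : 0 < x -> exists n, a n <= x <= b n.
  (* An integer above x + 1/x bounds both [x] and its inverse. *)
  move=> x0; exists (Num.truncn (x + x^-1)); rewrite /a /b.
  have := truncnS_gt (x + x^-1); set n := Num.truncn _ => xn.
  have xn2 : x + x^-1 <= n.+2%:R by rewrite (le_trans (ltW xn))// ler_nat.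
  apply/andP; split; last by apply: le_trans xn2; rewrite lerDl invr_ge0 ltW.
  rewrite -[leRHS]invrK lef_pV2 ?posrE ?invr_gt0//.
  by apply: le_trans xn2; rewrite lerDr ltW.
have -> : `]0%R, +oo[%classic = \bigcup_n `[a n, b n]%classic :> set R.
  by rewrite bigcup_itv.
have {1}<- : \bigcup_n `[F (b n), F (a n)]%classic =
  \bigcup_n `[a n, b n]%classic :> set R.
  rewrite !bigcup_itv//.
  - by move=> n; exact: F_gt0.
  - by move=> m n mn; apply: F_nincr => //; exact: nb.
  - by move=> m n mn; apply: F_nincr => //; exact: da.
  (* The point that [F] sends to [x] is (2x)^(-1/2); an interval around it is mapped to one around
     [x]. *)
  - move=> x x0; have y0 : 0 < (x * 2) `^ (- 2^-1) by apply/powR_gt0/mulr_gt0.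
    have xE : F ((x * 2) `^ (- 2^-1)) = x.
      by rewrite /F -powRrM mulrNN mulVf// powRr1 ?mulfK// mulr_ge0// ltW.
    have [n /andP[an nb']] := abx _ y0; exists n.
    by rewrite -xE !F_nincr.
have cvg1 : (\int[mu]_(v in `[F (b n), F (a n)]) (G v)%:E)%E @[n --> \oo] -->
    (\int[mu]_(v in \bigcup_n `[F (b n), F (a n)]%classic) (G v)%:E)%E.
  apply: ge0_nondecreasing_set_cvg_integral => //.
  - move=> m n mn; rewrite subsetEset; apply: subset_itv; rewrite bnd_simp.
      by apply: F_nincr => //; exact: nb.
    by apply: F_nincr => //; exact: da.
  - by move=> n; exact/measurable_EFinP/measurable_funTS.
  - by move=> n x _; rewrite lee_fin.
have cvg2 : (\int[mu]_(s in `[a n, b n]) (G (s `^ (- 2) / 2) * s `^ (- 3))%:E)%E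
    @[n --> \oo] -->
    (\int[mu]_(s in \bigcup_n `[a n, b n]%classic) (G (s `^ (- 2) / 2) * s `^
      (- 3))%:E)%E.
  apply: ge0_nondecreasing_set_cvg_integral => //.
  - move=> m n mn; rewrite subsetEset; apply: subset_itv; rewrite bnd_simp.
      exact: da.
    exact: nb.
  - move=> n; apply/measurable_EFinP/measurable_funTS/measurable_funM.
      apply: measurableT_comp => //; apply: measurable_funM => //;
        exact: measurable_powR.
    exact: measurable_powR.
  - by move=> n x _; rewrite lee_fin mulr_ge0 ?powR_ge0.
have E n := integral_substF (a0 n) (ab n) cG.
by move: cvg1; rewrite (eq_cvg _ _ E) => cvg1; exact: (cvg_unique _ cvg1 cvg2).
Qed.

End half_inverse_square.

(** At v = s^-2 / 2 the power v^(m/2 - 1) is 2^(1 - m/2) s^(2 - m), and the Jacobian s^-3 completes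
    the exponent to -(m + 1). *)
Lemma integral_inv_gamma_fun1 (m : R) :
  (\int[mu]_(v in `]0%R, +oo[) (v `^ (m / 2 - 1) * expR (- v))%:E =
   (2 `^ (1 - m / 2))%:E * \int[mu]_(s in `]0%R, +oo[)
     (inv_gamma_fun m 1 s)%:E)%E.
Proof.
rewrite [LHS]ge0_integral_half_inverse_square.
- rewrite -ge0_integralZl//.
  + apply: eq_integral => s; rewrite inE/= in_itv/= andbT => s0.
    rewrite -EFinM /inv_gamma_fun expr1n mulr1; congr EFin.
    rewrite powRM ?powR_ge0// -[X in (_ * X `^ _) * _ * _](powR_inv1
      (ler0n R 2)).
    rewrite -!powRrM (_ : -1 * (m / 2 - 1) = 1 - m / 2); last by ring.
    rewrite (_ : - (m + 1) = - 2 * (m / 2 - 1) + - 3); last by field.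
    by rewrite (@powRD _ s) ?(gt_eqF s0) ?implybT//; ring.
  + by apply/measurable_EFinP/measurable_funTS; exact: measurable_inv_gamma_fun.
  + by move=> x _; rewrite lee_fin inv_gamma_fun_ge0.
- apply: measurable_funM; first exact: measurable_powR.
  by apply: measurableT_comp => //; exact: measurableT_comp.
- by move=> x; rewrite mulr_ge0 ?powR_ge0 ?expR_ge0.
- move=> x x0; apply: cvgM; first exact: continuous_powR_gt0.
  apply: (cvg_comp _ expR); last exact: continuous_expR.
  exact: (@cvgN _ R^o).
Qed.

End inverse_gamma_integral.

(** * The standard Gaussian measure on R^n and its rotations and dilations *)

Section gaussian_measure.
Context {R : realType}.
Local Open Scope ereal_scope.

Lemma integral_inv_gamma_fun (m c : R) : (1 <= m)%R -> (0 < c)%R ->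
  \int[lebesgue_measure]_(s in `]0%R, +oo[) (inv_gamma_fun m c s)%:E =
  (2 `^ (m / 2 - 1) * Gamma (m / 2) * c `^ (- m))%:E.
Proof.
move=> m1 c0; rewrite integral_inv_gamma_funE// muleC.
have J_lty := integral_inv_gamma_fun_lty m1.
have GammaE := integral_inv_gamma_fun1 m.
rewrite /Gamma /Rintegral GammaE.
have J0 : 0 <= \int[@lebesgue_measure R]_(s in `]0%R, +oo[)
  (inv_gamma_fun m 1 s)%:E.
  by apply: integral_ge0 => s _; rewrite lee_fin inv_gamma_fun_ge0.
have J_fin := ge0_fin_numE J0; rewrite J_lty in J_fin.
rewrite -(fineK J_fin) -!EFinM; congr EFin; rewrite /= mulrA.
rewrite -powRD; last by rewrite (_ : (2 == 0 :> R)%R =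
  false) ?implybT// pnatr_eq0.
by rewrite (_ : m / 2 - 1 + (1 - m / 2) = 0)%R ?powRr0 ?mul1r//; ring.
Qed.

(** The factor [normal_peak 1 ^+ n] is (2 pi)^(-n/2). Written through [dotv t t], the density is
    visibly invariant under isometries. *)
Definition gauss_pdf n (t : n.-tuple R) : R :=
  normal_peak 1 ^+ n * expR (- (dotv t t / 2)).

Lemma gauss_pdf_ge0 n (t : n.-tuple R) : (0 <= gauss_pdf t)%R.
Proof. by rewrite mulr_ge0 ?expR_ge0// exprn_ge0// normal_peak_ge0. Qed.

Lemma measurable_gauss_pdf n :
  measurable_fun [set: Rn R n] (fun t : Rn R n => gauss_pdf t).
Proof.
apply: measurable_funM => //; apply: measurableT_comp => //.
apply: measurableT_comp => //; apply: measurable_funM => //.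
exact: measurable_dotv.
Qed.

Lemma prod_normal_pdf n (t : n.-tuple R) :
  (\prod_(i < n) normal_pdf 0 1 (tnth t i) = gauss_pdf t)%R.
Proof.
rewrite /gauss_pdf; under eq_bigr do rewrite normal_pdfE ?oner_eq0//.
rewrite big_split/= prodr_const card_ord; congr (_ * _)%R.
rewrite /normal_fun /dotv mulr_suml -sumrN expR_sum; apply: eq_bigr => i _.
by congr expR; rewrite subr0 expr1n expr2; field.
Qed.

Lemma ge0_integral_normal_prob (f : measurableTypeR R -> \bar R) :
  measurable_fun setT f -> (forall x, 0 <= f x) ->
  \int[N01 R]_x f x = \int[lebesgue_measure]_x (f x * (normal_pdf 0 1 x)%:E).
Proof.
apply: (@ge0_integral_density _ _ _ lebesgue_measure (N01 R)).
- exact: measurable_normal_pdf.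
- by move=> x; exact: normal_pdf_ge0.
- by [].
Qed.

Lemma ge0_integral_gaussian n (f : Rn R n -> \bar R) :
  measurable_fun setT f -> (forall x, 0 <= f x) ->
  \int[gaussian R n]_t f t =
  \int[@lebesgue_measuren R n]_t (f t * (gauss_pdf t)%:E).
Proof.
move=> mf f0; rewrite (integral_power_measure_density (mu := lebesgue_measure)
  (rho := normal_pdf 0 1))//.
- by apply: eq_integral => t _; rewrite prod_normal_pdf.
- exact: measurable_normal_pdf.
- by move=> x; exact: normal_pdf_ge0.
- exact: ge0_integral_normal_prob.
Qed.

Lemma gaussian_setT n : gaussian R n setT = 1.
Proof.
rewrite (_ : setT = [set t : Rn R n | forall i : 'I_n, setT (tnth t i)]);
  last first.
  by apply/seteqP; split.
rewrite (power_measure_box (N01 R) (fun i : 'I_n => measurableT)).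
by rewrite big1// => i _; exact: probability_setT.
Qed.

(** Provides the mass 1 of the weight in the invariance argument; it is read off from the product
    law being a probability. *)
Lemma integral_gauss_pdf n :
  \int[@lebesgue_measuren R n]_t (gauss_pdf t)%:E = 1.
Proof.
rewrite -(gaussian_setT n) -[RHS]mul1e -integral_cst// ge0_integral_gaussian//.
by under [RHS]eq_integral do rewrite mul1e.
Qed.

(** The Gaussian density plays two parts: it is the invariant weight for the isometry [lincomb e],
    and as a factor of the integrand it is unchanged by that isometry. Removing the dilation by [r]
    then costs r^-n. *)
Lemma ge0_integral_gaussian_scale_lincomb n (e : 'I_n -> n.-tuple R) (r : R)
    (f : Rn R n -> \bar R) :
  orthonormal_basis e -> (0 < r)%R ->
  measurable_fun setT f -> (forall x, 0 <= f x) ->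
  \int[gaussian R n]_x f (scalev r (lincomb e x)) =
  \int[@lebesgue_measuren R n]_t (f t * (r^-1 ^+ n * gauss_pdf
    (scalev r^-1 t))%:E).
Proof.
move=> he r0 mf f0.
have mfr : measurable_fun setT (fun x : Rn R n => f (scalev r x)).
  by apply: measurableT_comp => //; exact: measurable_scalev.
have mO : measurable_fun setT (lincomb e : Rn R n -> Rn R n).
  exact: measurable_lincomb.
have mpdf := @measurable_gauss_pdf n.
rewrite ge0_integral_gaussian//; last exact: (measurableT_comp mfr mO).
have gaussO x : gauss_pdf (lincomb e x) = gauss_pdf x.
  by rewrite /gauss_pdf dotv_lincomb.
(* The whole integrand is now a function of [lincomb e x]. *)
under eq_integral do rewrite -gaussO.
rewrite (ge0_integral_lebesguen_isometry (O := lincomb e) (w := fun x =>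
  (gauss_pdf x)%:E)
  (g := fun x => f (scalev r x) * (gauss_pdf x)%:E))//; first last.
- by move=> x; rewrite mule_ge0// lee_fin gauss_pdf_ge0.
- by apply: emeasurable_funM => //; exact/measurable_EFinP.
- exact: integral_gauss_pdf.
- by move=> x; rewrite gaussO.
- by move=> x; rewrite lee_fin gauss_pdf_ge0.
- exact/measurable_EFinP.
- by move=> y; exact: lincomb_translate.
have scalevK (x : Rn R n) : scalev r^-1 (scalev r x) = x.
  by apply/eq_from_tnth => i; rewrite !tnth_mktuple mulKf// gt_eqF.
have mpdfr : measurable_fun setT (fun x : Rn R n => gauss_pdf (scalev r^-1 x)).
  by apply: (measurableT_comp mpdf); exact: measurable_scalev.
pose g (x : Rn R n) := f x * (gauss_pdf (scalev r^-1 x))%:E.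
transitivity (\int[@lebesgue_measuren R n]_x g (scalev r x)).
  by apply: eq_integral => x _; rewrite /g scalevK.
rewrite (ge0_integral_lebesguen_scalev (lt0r_neq0 r0)).
- rewrite gtr0_norm// -ge0_integralZl_EFin ?exprn_ge0 ?invr_ge0 ?(ltW r0)//.
  + by apply: eq_integral => x _; rewrite muleCA -EFinM.
  + by move=> x _; rewrite mule_ge0// lee_fin gauss_pdf_ge0.
  + by apply: emeasurable_funM => //; exact/measurable_EFinP.
- by apply: emeasurable_funM => //; exact/measurable_EFinP.
- by move=> x; rewrite mule_ge0// lee_fin gauss_pdf_ge0.
Qed.

End gaussian_measure.

(** * Trading a Gaussian direction and a radius for a point of R^n *)

Section radial_integral.
Context {R : realType}.
Local Open Scope ereal_scope.

Lemma dotv_ge0 n (t : n.-tuple R) : (0 <= dotv t t)%R.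
Proof. by apply: sumr_ge0 => i _; rewrite -expr2 sqr_ge0. Qed.

Lemma norm2_sqr n (t : n.-tuple R) : (norm2 t ^+ 2 = dotv t t)%R.
Proof. by rewrite sqr_sqrtr// dotv_ge0. Qed.

Lemma measurable_dotvv n : measurable_fun [set: Rn R n]
  (fun t : Rn R n => dotv t t).
Proof. exact: measurable_dotv. Qed.

Lemma measurable_norm2 n : measurable_fun [set: Rn R n]
  (fun t : Rn R n => norm2 t).
Proof.
rewrite (_ : (fun t => _) = fun t : Rn R n => dotv t t `^ 2^-1)%R; last first.
  by apply/funext => t; rewrite powR12_sqrt// dotv_ge0.
apply: (measurableT_comp (measurable_powR _)).
exact: measurable_dotvv.
Qed.

Lemma measurable_dotv_eq0 n : measurable [set t : Rn R n | dotv t t = 0%R].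
Proof.
rewrite -[X in measurable X]setTI.
exact: (@measurable_dotvv n measurableT _ (measurable_set1 0%R)).
Qed.

(** The origin is a box with all sides of length 0, and the product of the lengths has at least one
    factor. *)
Lemma lebesgue_measuren_dotv_eq0 n : (0 < n)%N ->
  @lebesgue_measuren R n [set t | dotv t t = 0%R] = 0.
Proof.
move=> n0; rewrite (_ : [set t | _] =
    [set t : Rn R n | forall i, ((0 : R) <= tnth t i <= (0 : R))%R]).
  rewrite (lebesgue_measuren_box (a := fun=> 0%R)
    (b := fun=> 0%R))// prodr_const card_ord subrr expr0n.
  by rewrite eqn0Ngt n0.
apply/seteqP; split => t /=.
  move=> /eqP; rewrite psumr_eq0 => [/allP t0 i|i _];
    last by rewrite -expr2 sqr_ge0.
  by have := t0 i (mem_index_enum _); rewrite /= mulf_eq0 orbb => /eqP ->;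
    rewrite lexx.
move=> t0; apply: big1 => i _.
have : 0%R == tnth t i :> R by rewrite eq_le t0.
by move=> /eqP <-; rewrite mul0r.
Qed.

(** The constant K_n: the normalization (2 pi)^(-n/2) times the constant of the inverse-gamma
    integral for m = n + alpha. *)
Definition radial_const (alpha : R) n : R :=
  (normal_peak 1 ^+ n *
   (2 `^ ((n%:R + alpha) / 2 - 1) * Gamma ((n%:R + alpha) / 2)))%R.

Lemma radial_const_ge0 (alpha : R) n : (0 <= radial_const alpha n)%R.
Proof.
have Gamma_ge0 : (0 <= Gamma ((n%:R + alpha) / 2))%R.
  by apply: Rintegral_ge0 => t _; rewrite mulr_ge0 ?powR_ge0 ?expR_ge0.
by rewrite /radial_const !mulr_ge0 ?powR_ge0 ?exprn_ge0 ?normal_peak_ge0.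
Qed.

Lemma integral_radial_gaussian n (e : 'I_n -> n.-tuple R) (alpha : R)
    (f : Rn R n -> \bar R) :
  (0 < n)%N -> (0 < alpha)%R -> orthonormal_basis e ->
  measurable_fun setT f -> (forall x, 0 <= f x) ->
  \int[lebesgue_measure]_(r in `]0%R, +oo[)
    (((r `^ (alpha + 1))^-1)%:E * \int[gaussian R n]_x f (scalev r
      (lincomb e x))) =
  (radial_const alpha n)%:E *
  \int[@lebesgue_measuren R n]_t (f t * ((norm2 t `^ (n%:R + alpha))^-1)%:E).
Proof.
move=> n0 alpha0 he mf f0.
set m := (n%:R + alpha)%R.
have m1 : (1 <= m)%R.
  by rewrite (@le_trans _ _ n%:R) ?ler1n// lerDl ltW.
pose D : set R := `]0%R, +oo[%classic.
have mD : measurable_fun [set: R] (\1_D : R -> R).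
  by apply: measurable_indic; exact: measurable_itv.
(* For r > 0 this kernel gathers r^(-alpha-1), the Jacobian r^-n and the Gaussian density at t / r;
   the indicator lets Tonelli's theorem run over the whole line. *)
pose k (z : measurableTypeR R * Rn R n) : R :=
  (\1_D z.1 * (normal_peak 1 ^+ n * inv_gamma_fun m (norm2 z.2) z.1))%R.
have k0 z : (0 <= k z)%R.
  by rewrite mulr_ge0// mulr_ge0 ?inv_gamma_fun_ge0// exprn_ge0//
    normal_peak_ge0.
have mfst : measurable_fun [set: measurableTypeR R * Rn R n] (fun z => z.1 : R).
  exact: measurable_fst.
have mk : measurable_fun setT k.
  apply: measurable_funM.
    exact: (measurableT_comp mD mfst).
  apply: measurable_funM => //; apply: measurable_funM.
    apply: measurableT_comp => //; apply: measurableT_comp => //.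
    apply: measurable_funM => //; apply: measurable_funM.
      exact: (measurableT_comp (measurable_powR _) mfst).
    apply: measurable_funX.
    exact: (measurableT_comp (@measurable_norm2 n) measurable_snd).
  exact: (measurableT_comp (measurable_powR _) mfst).
have kE (r : R) t : (0 < r)%R ->
    ((r `^ (alpha + 1))^-1 * (r^-1 ^+ n * gauss_pdf (scalev r^-1 t)) =
      k (r, t))%R.
  move=> r0; rewrite /k/= indicE mem_set ?mul1r;
    last by rewrite /D/= in_itv/= r0.
  rewrite /gauss_pdf dotv_scalel dotv_scaler /inv_gamma_fun norm2_sqr.
  have -> : (r `^ (- (m + 1)) = (r `^ (alpha + 1))^-1 * r^-1 ^+ n)%R.
    rewrite -powRN exprVn -(powR_invn n (ltW r0)) -powRD.
      by congr (_ `^ _)%R; rewrite /m; ring.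
    by rewrite (gt_eqF r0) implybT.
  rewrite (powR_invn 2 (ltW r0)) -exprVn expr2 (mulrA (r^-1)%R).
  by move: (expR _) ((_ `^ _)^-1)%R (r^-1 ^+ n)%R (normal_peak 1 ^+ n)%R => *;
    ring.
transitivity (\int[lebesgue_measure]_r \int[@lebesgue_measuren R n]_t (f t *
  (k (r, t))%:E)).
  rewrite integral_mkcond; apply: eq_integral => r _; rewrite patchE.
  case: ifPn => [|/negP rD]; last first.
    apply/esym/integral0_eq => t _; rewrite /k/= indicE memNset ?mul0r ?mule0//.
    by move=> rD'; apply: rD; rewrite inE.
  rewrite inE/= in_itv/= andbT => r0.
  rewrite (ge0_integral_gaussian_scale_lincomb he r0)// -ge0_integralZl_EFin.
  - by apply: eq_integral => t _; rewrite muleCA -EFinM kE.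
  - exact: measurableT.
  - by move=> t _; rewrite mule_ge0// lee_fin mulr_ge0 ?gauss_pdf_ge0//
      exprn_ge0// invr_ge0 ltW.
  - apply: emeasurable_funM => //; apply/measurable_EFinP/measurable_funM => //.
    apply: (measurableT_comp (@measurable_gauss_pdf R n)).
    exact: measurable_scalev.
  - by rewrite invr_ge0 powR_ge0.
have mfk : measurable_fun setT (fun z : measurableTypeR R * Rn R n => f z.2 *
  (k z)%:E).
  apply: emeasurable_funM; last exact/measurable_EFinP.
  exact: measurableT_comp.
have fk0 z : 0 <= f z.2 * (k z)%:E by rewrite mule_ge0// lee_fin.
rewrite (fubini_tonelli (m1 := lebesgue_measure) (m2 := @lebesgue_measuren R n)
  (fun z => f z.2 * (k z)%:E))//=.
have mN := @measurable_dotv_eq0 n.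
have N0 := lebesgue_measuren_dotv_eq0 n0.
have mnorm : measurable_fun [set: Rn R n] (fun t => (norm2 t `^ m)^-1)%R.
  under eq_fun do rewrite -powRN.
  exact: (measurableT_comp (measurable_powR _) (@measurable_norm2 n)).
(* At the origin the two sides may differ: the integral over [r] diverges, whereas the inverse power
   of the norm has the conventional value 0. This null set is removed from both. *)
rewrite (ge0_negligible_integral mN measurableT _ _ N0); last 2 first.
- exact: (measurable_fun_fubini_tonelli_G (m1 := lebesgue_measure) _ mfk fk0).
- by move=> t _; apply: integral_ge0 => r _; exact: (fk0 (r, t)).
rewrite [in RHS](ge0_negligible_integral mN measurableT _ _ N0); last 2 first.
- by apply: emeasurable_funM => //; exact/measurable_EFinP.
- by move=> t _; rewrite mule_ge0// lee_fin invr_ge0 powR_ge0.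
rewrite -ge0_integralZl_EFin.
- apply: eq_integral => t; rewrite inE => -[_ /= tN].
  have t0 : (0 < norm2 t)%R by rewrite sqrtr_gt0 lt_neqAle dotv_ge0 eq_sym
    andbT; apply/eqP.
  rewrite ge0_integralZl//; last 2 first.
  + by apply/measurable_EFinP; exact: (measurable_fun_pair1 _ mk).
  + by move=> r _; rewrite lee_fin.
  rewrite [RHS]muleCA; congr (_ * _); rewrite muleC.
  transitivity (\int[lebesgue_measure]_(r in `]0%R, +oo[)
      ((normal_peak 1 ^+ n)%:E * (inv_gamma_fun m (norm2 t) r)%:E)).
    rewrite [RHS]integral_mkcond; apply: eq_integral => r _.
    by rewrite patchE /k/= indicE; case: ifPn => _; rewrite ?mul1r ?mul0r.
  rewrite ge0_integralZl//; last 3 first.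
  + by apply/measurable_EFinP/measurable_funTS; exact: measurable_inv_gamma_fun.
  + by move=> r _; rewrite lee_fin inv_gamma_fun_ge0.
  + by rewrite lee_fin exprn_ge0// normal_peak_ge0.
  rewrite integral_inv_gamma_fun// -!EFinM; congr EFin.
  by rewrite powRN /radial_const -/m; ring.
- exact: measurableD.
- by move=> t _; rewrite mule_ge0// lee_fin invr_ge0 powR_ge0.
- by apply: measurable_funTS; apply: emeasurable_funM => //;
    exact/measurable_EFinP.
- exact: radial_const_ge0.
Qed.

(** Besides the factor pi^(-n/2) and the Gamma values, which match, the exponents of 2 add up:
    alpha/2 - n/2 + (n + alpha)/2 - 1 = alpha - 1. *)
Lemma c_constE (alpha : R) n :
  (c_const alpha n = cH_const alpha * radial_const alpha n)%R.
Proof.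
rewrite /c_const /cH_const /radial_const /normal_peak expr1n mul1r.
have two0 : (0 < 2 :> R)%R by [].
have pi0 : (0 < pi :> R)%R by exact: pi_gt0.
have n2 x y : (2 `^ (x + y) = 2 `^ x * 2 `^ y :> R)%R.
  by rewrite powRD// (gt_eqF two0) implybT.
have -> : ((Num.sqrt (pi *+ 2))^-1 ^+ n =
  2 `^ (- (n%:R / 2)) * (pi `^ (n%:R / 2))^-1 :> R)%R.
  have pi20 : (0 <= pi *+ 2 :> R)%R by rewrite mulrn_wge0// ltW.
  rewrite -(powR12_sqrt pi20) exprVn -(powR_mulrn n (powR_ge0 _ _)).
  rewrite -powRrM (mulrC _ n%:R) -(mulr_natl pi).
  rewrite (powRM _ (ltW two0) (ltW pi0)).
  by rewrite invfM powRN.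
rewrite invfM.
have -> : (2 `^ (alpha - 1) = 2 `^ (alpha / 2) * (2 `^ (- (n%:R / 2)) *
    2 `^ ((n%:R + alpha) / 2 - 1)) :> R)%R.
  by rewrite -!n2; congr (_ `^ _)%R; field.
ring.
Qed.

End radial_integral.

(** * Independence and conditional expectation *)

Section product_uniqueness.
Local Open Scope ereal_scope.

Lemma measurable_box d (T : measurableType d) n (A : 'I_n -> set T) :
  (forall i, measurable (A i)) ->
  measurable [set t : n.-tuple T | forall i, A i (tnth t i)].
Proof.
move=> mA; rewrite (_ : [set t | _] =
    \bigcap_(i in setT) ((fun t : n.-tuple T => tnth t i) @^-1` A i)).
  apply: fin_bigcap_measurable => // i _; rewrite -[X in measurable X]setTI.
  exact: measurable_tnth.
by apply/seteqP; split => t /= h i; [move=> _|]; exact: h.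
Qed.

(** Boxes are stable under intersection and generate the product sigma-algebra, so two measures, of
    which one is finite, that agree on boxes are equal. *)
Lemma tuple_measure_unique d (T : measurableType d) (R : realType) n
    (m1 m2 : {measure set (n.-tuple T) -> \bar R}) :
  m1 setT < +oo ->
  (forall A : 'I_n -> set T, (forall i, measurable (A i)) ->
    m1 [set t | forall i, A i (tnth t i)] =
      m2 [set t | forall i, A i (tnth t i)]) ->
  forall B, measurable B -> m1 B = m2 B.
Proof.
move=> m1T m12.
pose G : set (set (n.-tuple T)) := [set B | exists2 A : 'I_n -> set T,
  forall i, measurable (A i) & B = [set t | forall i, A i (tnth t i)]].
have GT : G setT by exists (fun=> setT) => //; apply/seteqP; split.
have G_meas B : G B -> measurable B.
  by move=> [A mA ->]; exact: measurable_box.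
have mG : measurable = <<s G >>.
  apply/seteqP; split; last first.
    by apply: smallest_sub => //; exact: sigma_algebra_measurable.
  (* To see that boxes generate, the identity is shown measurable coordinate by coordinate: a
     condition on one coordinate is a box with [setT] elsewhere. *)
  have mid : measurable_fun [set: g_sigma_algebraType G]
    (id : g_sigma_algebraType G -> n.-tuple T).
    apply/measurable_fun_tnthP => i _ A mA; rewrite setTI.
    apply: sub_sigma_algebra; exists (fun j => if j == i then A else setT).
      by move=> j; case: ifP.
    apply/seteqP; split => t /=.
      by move=> At j; case: eqP => // ->.
    by move=> /(_ i); rewrite eqxx.
  by move=> B mB; have := mid measurableT B mB; rewrite setTI.
apply: (measure_unique G (fun=> setT)) => //.
- move=> _ _ [A1 mA1 ->] [A2 mA2 ->]; exists (fun i => A1 i `&` A2 i).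
    by move=> i; exact: measurableI.
  apply/seteqP; split => t /=.
    by move=> [h1 h2] i; split.
  by move=> h; split => i; have [] := h i.
- by rewrite bigcup_const.
- by move=> _ [A mA ->]; exact: m12.
Qed.

Lemma prod_measure_unique d1 d2 (T1 : measurableType d1)
  (T2 : measurableType d2)
    (R : realType) (m1 m2 : {measure set (T1 * T2) -> \bar R}) :
  m1 setT < +oo ->
  (forall A B, measurable A -> measurable B -> m1 (A `*` B) = m2 (A `*` B)) ->
  forall X, measurable X -> m1 X = m2 X.
Proof.
move=> m1T m12.
pose G : set (set (T1 * T2)) := [set A `*` B | A in measurable & B in
  measurable].
apply: (measure_unique G (fun=> setT)) => //.
- exact: measurable_prod_measurableType.
- move=> _ _ [A1 mA1 [B1 mB1 <-]] [A2 mA2 [B2 mB2 <-]].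
  exists (A1 `&` A2); first exact: measurableI.
  exists (B1 `&` B2); first exact: measurableI.
  by rewrite setXI.
- by exists setT => //; exists setT => //; rewrite setXTT.
- by rewrite bigcup_const.
- by move=> _ [A mA [B mB <-]]; exact: m12.
Qed.

End product_uniqueness.

Section independence.
Context d (T : measurableType d) (R : realType) (P : probability T R).
Local Open Scope ereal_scope.

Definition independent_of d1 d2 (T1 : measurableType d1)
  (T2 : measurableType d2)
    (U : T -> T1) (V : T -> T2) :=
  forall A B, measurable A -> measurable B ->
    P (U @^-1` A `&` V @^-1` B) = P (U @^-1` A) * P (V @^-1` B).

Lemma measurable_preimage d1 (T1 : measurableType d1) (U : T -> T1) A :
  measurable_fun setT U -> measurable A -> measurable (U @^-1` A).
Proof. by move=> mU mA; rewrite -[X in measurable X]setTI; exact: mU. Qed.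

(** The event [E] carries the other variables along: both sides are finite measures in [B] that
    agree on boxes. Several vectors can thus be passed from boxes to general sets one after the
    other. *)
Lemma power_measure_independent d1 (S : measurableType d1) n
  (nu : probability S R)
    (Z : T -> n.-tuple S) (E : set T) :
  measurable_fun setT Z -> measurable E ->
  (forall A : 'I_n -> set S, (forall i, measurable (A i)) ->
    P (Z @^-1` [set t | forall i, A i (tnth t i)] `&` E) =
      P E * \prod_(i < n) nu (A i)) ->
  forall B, measurable B -> P (Z @^-1` B `&` E) =
    P E * @power_measure _ S R nu n B.
Proof.
move=> mZ mE ZE B mB.
have PE0 : (0 <= fine (P E))%R by rewrite fine_ge0.
have PE_fin : P E \is a fin_num by exact: fin_num_measure.
pose m1 := measure_function_pushforward__canonical__measure_function_Measure
  (mrestr P mE) mZ.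
pose m2 := mscale (NngNum PE0) (@power_measure _ S R nu n).
suff : m1 B = m2 B by rewrite /m1/= /pushforward/= /mrestr /m2/= /mscale/=
  fineK.
apply: tuple_measure_unique => //.
  by rewrite /m1/= /pushforward/= /mrestr preimage_setT setTI ltey_eq PE_fin.
move=> A mA; rewrite /m1/= /pushforward/= /mrestr /m2/= /mscale/= fineK//.
by rewrite ZE// (power_measure_box nu mA).
Qed.

End independence.

Section conditional.
Context d (T : measurableType d) (R : realType) (P : probability T R).
Local Open Scope ereal_scope.

Lemma bounded_integrable (f : T -> R) (M : R) (A : set T) :
  measurable A -> measurable_fun [set: T] f -> (forall w, `|f w| <= M)%R ->
  P.-integrable A (EFin \o f).
Proof.
move=> mA mf fM; apply: measurable_bounded_integrable => //.
- by rewrite ltey_eq fin_num_measure.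
- exact: measurable_funTS.
- exists M; split; first exact: num_real.
  by move=> N MN w _ /=; exact: le_trans (fM w) (ltW MN).
Qed.

Lemma ge0_integral_pair d1 d2 (T1 : measurableType d1) (T2 : measurableType d2)
    (U : T -> T1) (V : T -> T2) (m1 : {sigma_finite_measure set T1 -> \bar R})
    (m2 : {sigma_finite_measure set T2 -> \bar R}) (h : T1 * T2 -> \bar R) :
  measurable_fun setT U -> measurable_fun setT V ->
  (forall A B, measurable A -> measurable B ->
    P (U @^-1` A `&` V @^-1` B) = m1 A * m2 B) ->
  measurable_fun setT h -> (forall z, 0 <= h z) ->
  \int[P]_w h (U w, V w) = \int[m1]_x \int[m2]_y h (x, y).
Proof.
move=> mU mV UV mh h0.
pose UV' w := (U w, V w).
have mUV : measurable_fun setT UV' by exact: measurable_fun_pair.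
rewrite -fubini_tonelli1//.
rewrite (eq_measure_integral
  (measure_function_pushforward__canonical__measure_function_Measure P mUV)).
  by rewrite /= ge0_integral_pushforward.
by move=> A mA _; exact: product_measure_unique.
Qed.

Section freezing.
Context d1 d2 (T1 : measurableType d1) (T2 : measurableType d2).
Variables (U : T -> T1) (V : T -> T2).
Hypothesis mU : measurable_fun setT U.
Hypothesis mV : measurable_fun setT V.

Lemma ge0_integral_independent (h : T1 * T2 -> \bar R) :
  independent_of P U V -> measurable_fun setT h -> (forall z, 0 <= h z) ->
  \int[P]_w h (U w, V w) = \int[P]_w \int[P]_w' h (U w, V w').
Proof.
move=> UV mh h0.
pose Um : {RV P >-> T1} := HB.pack U (isMeasurableFun.Build _ _ _ _ U mU).
pose Vm : {RV P >-> T2} := HB.pack V (isMeasurableFun.Build _ _ _ _ V mV).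
rewrite (ge0_integral_pair (m1 := distribution P Um)
  (m2 := distribution P Vm))//.
rewrite ge0_integral_distribution//=; last 2 first.
- exact: (measurable_fun_fubini_tonelli_F (m2 := distribution P Vm) h).
- by move=> x; exact: integral_ge0.
apply: eq_integral => w _; rewrite ge0_integral_distribution//.
exact: measurable_fun_pair2.
Qed.

Variable h : T1 * T2 -> R.
Hypothesis mh : measurable_fun [set: T1 * T2] h.
Hypothesis h1 : forall z, (`|h z| <= 1)%R.

(** The mean of h(u, V) with [u] frozen. For independent [U] and [V], its composite with [U] is a
    version of E(h(U, V) | U). *)
Definition frozen_mean (u : T1) : R := fine (\int[P]_w (h (u, V w))%:E).

Let mhV u : measurable_fun [set: T] (fun w => h (u, V w)).
Proof. by apply: (measurableT_comp (measurable_fun_pair2 _ mh)). Qed.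

Let int_h u : P.-integrable setT (fun w => (h (u, V w))%:E).
Proof. exact: (bounded_integrable (M := 1)). Qed.

Let frozen_meanE u : (frozen_mean u)%:E = \int[P]_w (h (u, V w))%:E.
Proof. by rewrite fineK//; exact: integrable_fin_num. Qed.

(* Shifting h by 1 makes it nonnegative, so that Tonelli applies without
   integrability conditions. *)
Let frozen_meanD1 u : (frozen_mean u + 1)%:E = \int[P]_w (h (u, V w) + 1)%:E.
Proof.
rewrite EFinD frozen_meanE.
under [RHS]eq_integral do rewrite EFinD.
rewrite integralD_EFin//.
  rewrite [X in _ = _ + X](_ : _ = \int[P]_x (cst 1 x))// integral_cst//.
  by rewrite mul1e; congr (_ + _); exact/esym/probability_setT.
- exact: int_h.
- by apply: (bounded_integrable (M := `|1|%R)).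
Qed.

Let hD1_ge0 z : (0 <= h z + 1)%R.
Proof. by have := h1 z; rewrite ler_norml => /andP[+ _];
  rewrite -lerBlDr sub0r. Qed.

Let mhD1 : measurable_fun [set: T1 * T2] (fun z => h z + 1)%R.
Proof. exact: measurable_funD. Qed.

Lemma measurable_frozen_mean : measurable_fun setT frozen_mean.
Proof.
have mF : measurable_fun [set: T1] (fun u => (frozen_mean u + 1)%:E).
  under eq_fun do rewrite frozen_meanD1.
  apply: (measurable_fun_fubini_tonelli_F (m2 := P) (fun z => (h
    (z.1, V z.2) + 1)%:E)).
    apply/measurable_EFinP; apply: (measurableT_comp mhD1).
    by apply: measurable_fun_pair => //; exact: measurableT_comp.
  by move=> z; rewrite lee_fin.
rewrite (_ : frozen_mean = fun u => (frozen_mean u + 1 - 1)%R).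
  by apply: measurable_funB => //; exact/measurable_EFinP.
by apply/funext => u; rewrite addrK.
Qed.

Lemma frozen_mean_le1 u : (`|frozen_mean u| <= 1)%R.
Proof.
rewrite -lee_fin -abse_EFin frozen_meanE.
apply: (le_trans (le_abse_integral _ _ _)) => //; first exact/measurable_EFinP.
rewrite -[leRHS](@probability_setT _ _ _ P) -[leRHS]mul1e -integral_cst//.
apply: ge0_le_integral => //.
- by apply/measurable_EFinP; exact: measurableT_comp.
- by move=> w _; rewrite lee_fin.
Qed.

Lemma is_cond_expectation_frozen_mean : independent_of P U V ->
  is_cond_expectation P (sigma_of U) (fun w => h (U w, V w)) (frozen_mean \o U).
Proof.
move=> UV.
have mgU : measurable_fun setT (frozen_mean \o U).
  by apply: measurableT_comp => //; exact: measurable_frozen_mean.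
have mhUV : measurable_fun setT (fun w => h (U w, V w)).
  by apply: (measurableT_comp mh); exact: measurable_fun_pair.
split.
- move=> B mB; exists (frozen_mean @^-1` B); last by rewrite setTI.
  exact: measurable_preimage measurable_frozen_mean mB.
- apply: (bounded_integrable (M := 1)) => //.
  by move=> w; exact: frozen_mean_le1.
move=> A [B mB <-]; rewrite setTI.
have mA : measurable (U @^-1` B) by exact: measurable_preimage.
have cst1 : P.-integrable (U @^-1` B) (EFin \o cst 1%R).
  exact: (bounded_integrable (M := `|1|%R)).
have E : \int[P]_(w in U @^-1` B) ((frozen_mean (U w))%:E + 1) =
         \int[P]_(w in U @^-1` B) ((h (U w, V w))%:E + 1).
  (* The event that [U] lies in [B] is written into the integrand, which becomes a nonnegative
     function of [(U, V)]. *)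
  pose h' (z : T1 * T2) := (\1_B z.1 * (h z + 1))%:E.
  have mh' : measurable_fun setT h'.
    apply/measurable_EFinP/measurable_funM => //.
    by apply: measurableT_comp => //; exact: measurable_indic.
  have h'0 z : 0 <= h' z by rewrite lee_fin mulr_ge0.
  have := ge0_integral_independent UV mh' h'0.
  rewrite /h'/= => H.
  rewrite integral_mkcond [RHS]integral_mkcond.
  transitivity (\int[P]_w \int[P]_w' (\1_B (U w) * (h (U w, V w') + 1))%:E).
    apply: eq_integral => w _; rewrite patchE indicE.
    have -> : (w \in U @^-1` B) = (U w \in B) by apply/idP/idP; rewrite !inE.
    case: ifPn => _; last by under eq_integral do rewrite mul0r;
      rewrite integral0.
    by under eq_integral do rewrite mul1r; rewrite -EFinD frozen_meanD1.
  rewrite -H; apply: eq_integral => w _; rewrite patchE indicE.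
  have -> : (w \in U @^-1` B) = (U w \in B) by apply/idP/idP; rewrite !inE.
  by case: ifPn => _; rewrite ?mul0r ?mul1r// EFinD.
have int1 : \int[P]_(w in U @^-1` B) (cst 1%R w)%:E \is a fin_num.
  exact: integrable_fin_num.
move: E; rewrite !integralD_EFin//.
- by move=> /(congr1 (fun z => z - \int[P]_(w in U @^-1` B) (cst 1%R w)%:E));
    rewrite !addeK.
- exact: (bounded_integrable (M := 1)).
- by apply: (bounded_integrable (M := 1)) => // w; exact: frozen_mean_le1.
Qed.

End freezing.

(** On the set where one version is at least the other, which belongs to the sigma-algebra of [U],
    their difference is nonnegative with integral 0, so it vanishes almost surely; the two orders
    together cover everything. *)
Lemma is_cond_expectation_unique d1 (T1 : measurableType d1) (U : T -> T1)
    (Z W W0 : T -> R) : measurable_fun setT U ->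
  is_cond_expectation P (sigma_of U) Z W ->
    is_cond_expectation P (sigma_of U) Z W0 ->
  {ae P, forall w, W w = W0 w}.
Proof.
move=> mU [mW iW WE] [mW0 iW0 W0E].
have sub A : sigma_of U A -> measurable A.
  by move=> [B mB <-]; rewrite setTI; exact: measurable_preimage.
have mWU (W' : T -> R) : (forall B, measurable B -> sigma_of U (W' @^-1` B)) ->
    measurable_fun [set: g_sigma_algebra_preimageType U] W'.
  by move=> mW' _ B mB; rewrite setTI; exact: mW'.
have aeA (W1 W2 : T -> R) :
    (forall B, measurable B -> sigma_of U (W1 @^-1` B)) ->
    (forall B, measurable B -> sigma_of U (W2 @^-1` B)) ->
    P.-integrable setT (EFin \o W1) -> P.-integrable setT (EFin \o W2) ->
    (forall A, sigma_of U A -> \int[P]_(w in A) (W1 w)%:E =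
      \int[P]_(w in A) (W2 w)%:E) ->
    {ae P, forall w, (W2 w <= W1 w)%R -> W1 w = W2 w}.
  move=> mW1 mW2 iW1 iW2 W12.
  pose A := (fun w => W1 w - W2 w)%R @^-1` `[0%R, +oo[%classic.
  (* Both functions are measurable on [T] equipped with the sigma-algebra of [U], hence so is their
     difference. *)
  have UA : sigma_of U A.
    have := measurable_funB (mWU _ mW1) (mWU _ mW2).
    by move=> /(_ measurableT `[0%R, +oo[%classic (measurable_itv _));
      rewrite setTI.
  have mA := sub _ UA.
  have iW1A := integrableS measurableT mA (@subsetT _ _) iW1.
  have iW2A := integrableS measurableT mA (@subsetT _ _) iW2.
  have m12 : measurable_fun A (fun w => (W1 w - W2 w)%:E).
    exact: measurable_int (integrableB mA iW1A iW2A).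
  have /(ae_eq_integral_abs P mA m12) : \int[P]_(w in A) `|(W1 w - W2 w)%:E| =
    0.
    transitivity (\int[P]_(w in A) (W1 w - W2 w)%:E).
      apply: eq_integral => w; rewrite inE /A/= in_itv/= andbT => w0.
      by rewrite ger0_norm.
    under eq_integral do rewrite EFinB.
    rewrite integralB_EFin// W12//.
    by rewrite subee//; exact: integrable_fin_num.
  apply: filterS => w Aw W21.
  have : A w by rewrite /A/= in_itv/= andbT subr_ge0.
  by move=> /Aw [/eqP]; rewrite subr_eq0 => /eqP.
have := aeA _ _ mW mW0 iW iW0 (fun A UA => etrans (WE A UA) (esym (W0E A UA))).
have := aeA _ _ mW0 mW iW0 iW (fun A UA => etrans (W0E A UA) (esym (WE A UA))).
apply: filterS2 => w H1 H2.
by case: (leP (W0 w) (W w)) => [/H2|/ltW/H1].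
Qed.

Lemma cond_expectation_frozen d1 d2 (T1 : measurableType d1)
  (T2 : measurableType d2)
    (U : T -> T1) (V : T -> T2) (h : T1 * T2 -> R) (Z : T -> R) :
  measurable_fun setT U -> measurable_fun setT V -> independent_of P U V ->
  measurable_fun setT h -> (forall z, `|h z| <= 1)%R ->
  (forall w, Z w = h (U w, V w)) ->
  measurable_fun setT (cond_expectation P U Z) /\
  {ae P, forall w, cond_expectation P U Z w = frozen_mean V h (U w)}.
Proof.
move=> mU mV UV mh h1 ZE.
have E : is_cond_expectation P (sigma_of U) Z (frozen_mean V h \o U).
  rewrite (_ : Z = fun w => h (U w, V w)); last exact/funext.
  exact: is_cond_expectation_frozen_mean.
have E' : is_cond_expectation P (sigma_of U) Z (cond_expectation P U Z).
  by apply: (@getPex _ [set W | is_cond_expectation P (sigma_of U) Z W]);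
    exists (frozen_mean V h \o U).
split; last exact: is_cond_expectation_unique E' E.
move: E' => [mW _ _] _ B mB; rewrite setTI.
by have [A mA <-] := mW _ mB; rewrite setTI; exact: measurable_preimage.
Qed.

End conditional.

Section independence_lemmas.
Context d (T : measurableType d) (R : realType) (P : probability T R).
Context d1 d2 d3 (T1 : measurableType d1) (T2 : measurableType d2)
  (T3 : measurableType d3).
Local Open Scope ereal_scope.

Lemma independent_of_comp (f : T1 -> T3) (U : T -> T1) (V : T -> T2) :
  measurable_fun setT f -> independent_of P U V -> independent_of P (f \o U) V.
Proof.
move=> mf UV A B mA mB; rewrite comp_preimage; apply: UV => //.
exact: measurable_preimage.
Qed.

(** Both sides are measures in the set for the pair, and they agree on rectangles, which
    generate. *)
Lemma independent_of_pair (U1 : T -> T1) (U2 : T -> T2) (V : T -> T3) :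
  measurable_fun setT U1 -> measurable_fun setT U2 -> measurable_fun setT V ->
  (forall A B C, measurable A -> measurable B -> measurable C ->
    P (U1 @^-1` A `&` (U2 @^-1` B `&` V @^-1` C)) =
    P (U1 @^-1` A `&` U2 @^-1` B) * P (V @^-1` C)) ->
  independent_of P (fun w => (U1 w, U2 w)) V.
Proof.
move=> mU1 mU2 mV H D C mD mC.
have mVC := measurable_preimage mV mC.
have mU : measurable_fun setT (fun w => (U1 w, U2 w))
  by exact: measurable_fun_pair.
have PC0 : (0 <= fine (P (V @^-1` C)))%R by rewrite fine_ge0.
have PC_fin : P (V @^-1` C) \is a fin_num by exact: fin_num_measure.
pose m1 := measure_function_pushforward__canonical__measure_function_Measure
  (mrestr P mVC) mU.
pose m2 := mscale (NngNum PC0)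
  (measure_function_pushforward__canonical__measure_function_Measure P mU).
suff : m1 D = m2 D.
  by rewrite /m1/= /pushforward/= /mrestr /m2/= /mscale/= fineK// muleC.
apply: prod_measure_unique => //.
  by rewrite /m1/= /pushforward/= /mrestr preimage_setT setTI ltey_eq PC_fin.
move=> A B mA mB; rewrite /m1/= /pushforward/= /mrestr /m2/= /mscale/= fineK//.
by rewrite muleC -H// setIA.
Qed.

End independence_lemmas.

(** * Joint law of the two Gaussian vectors and (X, Y) *)

Section gaussian_system_law.
Context d (T : measurableType d) (R : realType) (P : probability T R).
Context (p q : nat) (X : T -> Rn R p) (Y : T -> Rn R q).
Context (xi : 'I_p -> T -> R) (eta : 'I_q -> T -> R).
Hypothesis mX : measurable_fun setT X.
Hypothesis mY : measurable_fun setT Y.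
Hypothesis hxi : gaussian_system P X Y xi eta.
Local Open Scope ereal_scope.

Let V w := (X w, Y w).
Let xiv w : Rn R p := [tuple xi i w | i < p].
Let etav w : Rn R q := [tuple eta j w | j < q].

Let mV : measurable_fun setT V. Proof. exact: measurable_fun_pair. Qed.

Lemma measurable_xiv : measurable_fun setT xiv.
Proof.
have [mxi _ _ _ _] := hxi; apply/measurable_fun_tnthP => i.
rewrite (_ : _ \o _ = xi i); first exact: mxi.
by apply/funext => w /=; rewrite tnth_mktuple.
Qed.

Lemma measurable_etav : measurable_fun setT etav.
Proof.
have [_ meta _ _ _] := hxi; apply/measurable_fun_tnthP => i.
rewrite (_ : _ \o _ = eta i); first exact: meta.
by apply/funext => w /=; rewrite tnth_mktuple.
Qed.

Let box (A : 'I_p -> set (measurableTypeR R)) (B : 'I_q ->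
  set (measurableTypeR R)) C :
  (forall i, measurable (A i)) -> (forall j, measurable (B j)) ->
    measurable C ->
  P (xiv @^-1` [set t | forall i, A i (tnth t i)] `&`
     (etav @^-1` [set t | forall j, B j (tnth t j)] `&` V @^-1` C)) =
  \prod_(i < p) N01 R (A i) * (\prod_(j < q) N01 R (B j) * P (V @^-1` C)).
Proof.
move=> mA mB mC; have [_ _ xiP etaP indep] := hxi.
pose F (k : option ('I_p + 'I_q)) : set T := match k with
  | None => V @^-1` C
  | Some (inl i) => xi i @^-1` A i
  | Some (inr j) => eta j @^-1` B j
  end.
(* Mutual independence is used for the full index set; later, components are dropped by taking
   [setT]. *)
have := indep [set: option ('I_p + 'I_q)]%SET F; rewrite -/V => indepF.
have -> : xiv @^-1` [set t | forall i, A i (tnth t i)] `&`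
     (etav @^-1` [set t | forall j, B j (tnth t j)] `&` V @^-1` C) =
   \bigcap_(i in [set i | i \in [set: option ('I_p + 'I_q)]%SET]) F i.
  apply/seteqP; split => w /=.
    move=> [hA [hB hC]] [[i|j]|] _ //=.
      by have := hA i; rewrite tnth_mktuple.
    by have := hB j; rewrite tnth_mktuple.
  move=> h; split; [|split].
  - by move=> i; rewrite tnth_mktuple; apply: (h (Some (inl i)));
      rewrite /= inE.
  - by move=> j; rewrite tnth_mktuple; apply: (h (Some (inr j)));
      rewrite /= inE.
  - by apply: (h None); rewrite /= inE.
rewrite indepF; last first.
  move=> [[i|j]|] _ /=.
  - by exists (A i); [exact: mA|rewrite setTI].
  - by exists (B j); [exact: mB|rewrite setTI].
  - by exists C => //; rewrite setTI.
rewrite (eq_bigl xpredT) => [|k]; last by rewrite inE.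
rewrite (bigD1 None)//= [X in _ * X = _](reindex_omap Some id) => [|[]//].
rewrite [X in _ * X = _](eq_bigl xpredT) => [|k]; last by rewrite eqxx.
rewrite big_sumType/= muleC -muleA; congr (_ * (_ * _)).
- by apply: eq_bigr => i _; exact: (xiP i _ (mA i)).
- by apply: eq_bigr => j _; exact: (etaP j _ (mB j)).
Qed.

Let prod1 n : \prod_(i < n) N01 R setT = 1.
Proof. by rewrite big1// => i _; exact: probability_setT. Qed.

Let box_setT n : [set t : Rn R n | forall i : 'I_n, setT (tnth t i)] = setT.
Proof. by apply/seteqP; split. Qed.

Let box_C (B : 'I_q -> set (measurableTypeR R)) C :
  (forall j, measurable (B j)) -> measurable C ->
  P (etav @^-1` [set t | forall j, B j (tnth t j)] `&` V @^-1` C) =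
  \prod_(j < q) N01 R (B j) * P (V @^-1` C).
Proof.
move=> mB mC; have := box (fun=> measurableT) mB mC.
by rewrite prod1 mul1e box_setT preimage_setT setTI.
Qed.

(** Here the box for [xi] becomes an arbitrary measurable set, while [eta] stays in a box;
    [joint_law] then does the same for [eta]. *)
Let xi_box (A : set (Rn R p)) (B : 'I_q -> set (measurableTypeR R)) C :
  measurable A -> (forall j, measurable (B j)) -> measurable C ->
  P (xiv @^-1` A `&` (etav @^-1` [set t | forall j, B j
    (tnth t j)] `&` V @^-1` C)) =
  \prod_(j < q) N01 R (B j) * P (V @^-1` C) * gaussian R p A.
Proof.
move=> mA mB mC; rewrite -box_C//.
apply: (power_measure_independent (nu := N01 R)) => //.
- exact: measurable_xiv.
- apply: measurableI; last exact: measurable_preimage.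
  by apply: measurable_preimage; [exact: measurable_etav|exact: measurable_box].
- by move=> A' mA'; rewrite box// box_C// muleC.
Qed.

Let joint_law (A : set (Rn R p)) (B : set (Rn R q)) C :
  measurable A -> measurable B -> measurable C ->
  P (xiv @^-1` A `&` (etav @^-1` B `&` V @^-1` C)) =
  gaussian R p A * gaussian R q B * P (V @^-1` C).
Proof.
move=> mA mB mC; rewrite setICA.
have E : P (xiv @^-1` A `&` V @^-1` C) = P (V @^-1` C) * gaussian R p A.
  have := xi_box mA (fun=> measurableT) mC.
  by rewrite prod1 mul1e box_setT preimage_setT setTI.
rewrite (power_measure_independent (nu := N01 R)
  (E := xiv @^-1` A `&` V @^-1` C))//.
- by rewrite E -muleA [LHS]muleC.
- exact: measurable_etav.
- apply: measurableI; last exact: measurable_preimage.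
  by apply: measurable_preimage => //; exact: measurable_xiv.
- by move=> B' mB'; rewrite setICA xi_box// E -muleA muleC.
Qed.

Lemma gaussian_system_law (A : set (Rn R p)) (B : set (Rn R q)) :
  measurable A -> measurable B ->
  P (xiv @^-1` A `&` etav @^-1` B) = gaussian R p A * gaussian R q B.
Proof.
move=> mA mB; have := joint_law mA mB measurableT.
by rewrite preimage_setT setIT probability_setT mule1.
Qed.

Lemma gaussian_system_independent :
  independent_of P (fun w => (xiv w, etav w)) V.
Proof.
apply: independent_of_pair => //;
  [exact: measurable_xiv|exact: measurable_etav|].
by move=> A B C mA mB mC; rewrite joint_law// gaussian_system_law.
Qed.

End gaussian_system_law.

(** * Proof of the theorem *)

Section squared_modulus.
Context {R : realType}.

Lemma sqmodE (z : R[i]) : sqmod z = complex.Re z ^+ 2 + complex.Im z ^+ 2.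
Proof. by case: z => a b; rewrite /sqmod/= sqr_sqrtr// addr_ge0// sqr_ge0. Qed.

(** An expression in six real components serves both the measurability proofs and the almost sure
    replacement of conditional expectations. *)
Lemma sqmod_subM (z z1 z2 : R[i]) :
  sqmod (z - z1 * z2) =
  (complex.Re z - (complex.Re z1 * complex.Re z2 -
    complex.Im z1 * complex.Im z2)) ^+ 2 +
  (complex.Im z - (complex.Re z1 * complex.Im z2 +
    complex.Im z1 * complex.Re z2)) ^+ 2.
Proof. by rewrite sqmodE; case: z z1 z2 => [a b] [a1 b1] [a2 b2]. Qed.

Lemma sqmod_ge0 (z : R[i]) : 0 <= sqmod z.
Proof. exact: sqr_ge0. Qed.

Lemma measurable_sqmod_subM d (T : measurableType d) (z z1 z2 : T -> R[i]) :
  measurable_fun [set: T] (fun w => complex.Re (z w)) ->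
  measurable_fun [set: T] (fun w => complex.Im (z w)) ->
  measurable_fun [set: T] (fun w => complex.Re (z1 w)) ->
  measurable_fun [set: T] (fun w => complex.Im (z1 w)) ->
  measurable_fun [set: T] (fun w => complex.Re (z2 w)) ->
  measurable_fun [set: T] (fun w => complex.Im (z2 w)) ->
  measurable_fun [set: T] (fun w => sqmod (z w - z1 w * z2 w)).
Proof.
move=> ma mb ma1 mb1 ma2 mb2; under eq_fun do rewrite sqmod_subM.
apply: measurable_funD; apply: measurable_funX; apply: measurable_funB => //.
  by apply: measurable_funB; exact: measurable_funM.
by apply: measurable_funD; exact: measurable_funM.
Qed.

End squared_modulus.

Section restricted_tonelli.
Context d1 d2 (T1 : measurableType d1) (T2 : measurableType d2) (R : realType).
Variables (m1 : {sigma_finite_measure set T1 -> \bar R})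
  (m2 : {sigma_finite_measure set T2 -> \bar R}).
Local Open Scope ereal_scope.

Lemma fubini_tonelli_restrict (D : set T1) (f : T1 * T2 -> \bar R) :
  measurable D -> measurable_fun setT f -> (forall z, 0 <= f z) ->
  \int[m1]_(x in D) \int[m2]_y f (x, y) = \int[m2]_y \int[m1]_(x in D) f (x, y).
Proof.
move=> mD mf f0.
pose g z := f z * (\1_D z.1)%:E.
have mg : measurable_fun setT g.
  apply: emeasurable_funM => //; apply/measurable_EFinP.
  by apply: measurableT_comp => //; exact: measurable_indic.
have g0 z : 0 <= g z by rewrite mule_ge0// lee_fin.
transitivity (\int[m1]_x \int[m2]_y g (x, y)).
  rewrite integral_mkcond epatch_indic; apply: eq_integral => x _ /=.
  rewrite -ge0_integralZr//.
  exact: measurable_fun_pair2.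
rewrite fubini_tonelli//; apply: eq_integral => y _.
by rewrite [RHS]integral_mkcond epatch_indic.
Qed.

End restricted_tonelli.

(** * Characteristic functions as frozen means *)

Section characteristic_functions.
Context d (T : measurableType d) (R : realType) (P : probability T R).
Context (p q : nat) (X : T -> Rn R p) (Y : T -> Rn R q).
Hypothesis mX : measurable_fun setT X.
Hypothesis mY : measurable_fun setT Y.

Let V w := (X w, Y w).
Let mV : measurable_fun setT V. Proof. exact: measurable_fun_pair. Qed.

(** Here [f] will be cos or sin. All three waves take the full pair [(X, Y)] as second argument,
    even when one component matters, so that the same [V] serves every frozen mean. *)
Definition wave2 (f : R -> R) (z : (Rn R p * Rn R q) * (Rn R p * Rn R q)) : R :=
  f (dotv z.1.1 z.2.1 + dotv z.1.2 z.2.2).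

Definition wavel (f : R -> R) (z : Rn R p * (Rn R p * Rn R q)) : R :=
  f (dotv z.1 z.2.1).

Definition waver (f : R -> R) (z : Rn R q * (Rn R p * Rn R q)) : R :=
  f (dotv z.1 z.2.2).

Lemma joint_char_funE t u : joint_char_fun P X Y t u =
  (frozen_mean P V (wave2 cos) (t, u) +i* frozen_mean P V (wave2 sin) (t, u))%C.
Proof. by rewrite /joint_char_fun /Cexpectation unlock. Qed.

Lemma char_funlE t : char_fun P X t =
  (frozen_mean P V (wavel cos) t +i* frozen_mean P V (wavel sin) t)%C.
Proof. by rewrite /char_fun /Cexpectation unlock. Qed.

Lemma char_funrE u : char_fun P Y u =
  (frozen_mean P V (waver cos) u +i* frozen_mean P V (waver sin) u)%C.
Proof. by rewrite /char_fun /Cexpectation unlock. Qed.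

Variable f : R -> R.
Hypothesis mf : measurable_fun [set: R] f.

Lemma measurable_wave2 : measurable_fun setT (wave2 f).
Proof.
apply: measurableT_comp => //; apply: measurable_funD; apply: measurable_dotv.
- by apply: measurableT_comp => //; exact: measurable_fst.
- by apply: measurableT_comp => //; exact: measurable_snd.
- by apply: measurableT_comp => //; exact: measurable_fst.
- by apply: measurableT_comp => //; exact: measurable_snd.
Qed.

Lemma measurable_wavel : measurable_fun setT (wavel f).
Proof.
apply: measurableT_comp => //; apply: measurable_dotv;
  first exact: measurable_fst.
by apply: measurableT_comp => //; exact: measurable_snd.
Qed.

Lemma measurable_waver : measurable_fun setT (waver f).
Proof.
apply: measurableT_comp => //; apply: measurable_dotv;
  first exact: measurable_fst.
by apply: measurableT_comp => //; exact: measurable_snd.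
Qed.

End characteristic_functions.

Section expected_squared_difference.
Context d (T : measurableType d) (R : realType) (P : probability T R).
Context (p q : nat) (X : T -> Rn R p) (Y : T -> Rn R q).
Hypothesis mX : measurable_fun setT X.
Hypothesis mY : measurable_fun setT Y.
Local Open Scope ereal_scope.

Let V w := (X w, Y w).
Let mV : measurable_fun setT V. Proof. exact: measurable_fun_pair. Qed.

Let mcos : measurable_fun [set: R] (@cos R).
Proof. by apply: continuous_measurable_fun; exact: continuous_cos. Qed.

Let msin : measurable_fun [set: R] (@sin R).
Proof. by apply: continuous_measurable_fun; exact: continuous_sin. Qed.

Let cos_le1 (x : R) : (`|cos x| <= 1)%R.
Proof. by rewrite ler_norml cos_geN1 cos_le1. Qed.

Let sin_le1 (x : R) : (`|sin x| <= 1)%R.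
Proof. by rewrite ler_norml sin_geN1 sin_le1. Qed.

Definition sq_char_diff (z : Rn R p * Rn R q) : R :=
  sqmod (joint_char_fun P X Y z.1 z.2 - char_fun P X z.1 * char_fun P Y z.2)%R.

Lemma measurable_sq_char_diff : measurable_fun setT sq_char_diff.
Proof.
have m2 (f : R -> R) : measurable_fun [set: R] f -> (forall x, `|f x| <= 1)%R ->
    measurable_fun [set: Rn R p * Rn R q] (fun z => frozen_mean P V (wave2 f)
      (z.1, z.2)).
  move=> mf f1; rewrite (_ : (fun z => _) = frozen_mean P V (wave2 f));
    last first.
    by apply/funext => -[].
  exact: (measurable_frozen_mean P mV (measurable_wave2 mf) (fun=> f1 _)).
have ml (f : R -> R) : measurable_fun [set: R] f -> (forall x, `|f x| <= 1)%R ->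
    measurable_fun [set: Rn R p * Rn R q] (fun z => frozen_mean P V
      (wavel f) z.1).
  move=> mf f1; apply: measurableT_comp => //.
  exact: (measurable_frozen_mean P mV (measurable_wavel mf) (fun=> f1 _)).
have mr (f : R -> R) : measurable_fun [set: R] f -> (forall x, `|f x| <= 1)%R ->
    measurable_fun [set: Rn R p * Rn R q] (fun z => frozen_mean P V
      (waver f) z.2).
  move=> mf f1; apply: measurableT_comp => //.
  exact: (measurable_frozen_mean P mV (measurable_waver mf) (fun=> f1 _)).
apply: measurable_sqmod_subM.
- by under eq_fun do rewrite joint_char_funE/=; exact: m2.
- by under eq_fun do rewrite joint_char_funE/=; exact: m2.
- by under eq_fun do rewrite (char_funlE P X Y)/=; exact: ml.
- by under eq_fun do rewrite (char_funlE P X Y)/=; exact: ml.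
- by under eq_fun do rewrite (char_funrE P X Y)/=; exact: mr.
- by under eq_fun do rewrite (char_funrE P X Y)/=; exact: mr.
Qed.

Context (e : 'I_p -> p.-tuple R) (e' : 'I_q -> q.-tuple R).
Context (xi : 'I_p -> T -> R) (eta : 'I_q -> T -> R).
Hypothesis hxi : gaussian_system P X Y xi eta.

Let xiv w : Rn R p := [tuple xi i w | i < p].
Let etav w : Rn R q := [tuple eta j w | j < q].

Lemma expectation_sqmod_cond_char_diff (r s : R) :
  'E_P[fun w => sqmod (cond_char_diff P X Y e e' xi eta r s w)] =
  \int[gaussian R p]_x \int[gaussian R q]_y
    (sq_char_diff (scalev r (lincomb e x), scalev s (lincomb e' y)))%:E.
Proof.
have mxi : measurable_fun setT xiv := measurable_xiv hxi.
have meta : measurable_fun setT etav := measurable_etav hxi.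
have mU : measurable_fun setT (fun w => (xiv w, etav w))
  by exact: measurable_fun_pair.
have UV : independent_of P (fun w => (xiv w, etav w)) V.
  exact: gaussian_system_independent hxi.
have xiV : independent_of P xiv V
  by exact: (independent_of_comp measurable_fst UV).
have etaV : independent_of P etav V
  by exact: (independent_of_comp measurable_snd UV).
pose A (x : Rn R p) : Rn R p := scalev r (lincomb e x).
pose B (y : Rn R q) : Rn R q := scalev s (lincomb e' y).
have mA : measurable_fun setT A
  by apply: measurable_scalev => //; exact: measurable_lincomb.
have mB : measurable_fun setT B
  by apply: measurable_scalev => //; exact: measurable_lincomb.
have xiXE w : (r * basis_dot e (xi ^~ w) (X w) = dotv (A (xiv w)) (X w))%R.
  by rewrite basis_dotE /A dotv_scalel.
have etaYE w : (s * basis_dot e' (eta ^~ w) (Y w) = dotv (B (etav w)) (Y w))%R.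
  by rewrite basis_dotE /B dotv_scalel.
have H2 (f : R -> R) : measurable_fun [set: R] f -> (forall x, `|f x| <= 1)%R ->
    let Z w := f (r * basis_dot e (xi ^~ w) (X w) + s * basis_dot e'
      (eta ^~ w) (Y w))%R in
    measurable_fun setT (cond_expectation P (fun w => (xiv w, etav w)) Z) /\
    {ae P, forall w, cond_expectation P (fun w => (xiv w, etav w)) Z w =
      frozen_mean P V (wave2 f) (A (xiv w), B (etav w))}.
  move=> mf f1 Z.
  apply: (cond_expectation_frozen (h := fun z => wave2 f
    ((A z.1.1, B z.1.2), z.2))) => //.
  - apply: (measurableT_comp (measurable_wave2 mf)).
    apply: measurable_fun_pair; last exact: measurable_snd.
    apply: measurable_fun_pair.
      by apply: measurableT_comp => //; apply: measurableT_comp => //;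
        exact: measurable_fst.
    by apply: measurableT_comp => //; apply: measurableT_comp => //;
      exact: measurable_fst.
  - by move=> z; exact: f1.
  - by move=> w; rewrite /Z xiXE etaYE.
have Hl (f : R -> R) : measurable_fun [set: R] f -> (forall x, `|f x| <= 1)%R ->
    let Z w := f (r * basis_dot e (xi ^~ w) (X w))%R in
    measurable_fun setT (cond_expectation P xiv Z) /\
    {ae P, forall w, cond_expectation P xiv Z w =
      frozen_mean P V (wavel f) (A (xiv w))}.
  move=> mf f1 Z.
  apply: (cond_expectation_frozen (h := fun z => wavel f (A z.1, z.2))) => //.
  - apply: (measurableT_comp (measurable_wavel mf)).
    by apply: measurable_fun_pair => //; exact: measurableT_comp.
  - by move=> z; exact: f1.
  - by move=> w; rewrite /Z xiXE.
have Hr (f : R -> R) : measurable_fun [set: R] f -> (forall x, `|f x| <= 1)%R ->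
    let Z w := f (s * basis_dot e' (eta ^~ w) (Y w))%R in
    measurable_fun setT (cond_expectation P etav Z) /\
    {ae P, forall w, cond_expectation P etav Z w =
      frozen_mean P V (waver f) (B (etav w))}.
  move=> mf f1 Z.
  apply: (cond_expectation_frozen (h := fun z => waver f (B z.1, z.2))) => //.
  - apply: (measurableT_comp (measurable_waver mf)).
    by apply: measurable_fun_pair => //; exact: measurableT_comp.
  - by move=> z; exact: f1.
  - by move=> w; rewrite /Z etaYE.
have [m2c a2c] := H2 _ mcos cos_le1; have [m2s a2s] := H2 _ msin sin_le1.
have [mlc alc] := Hl _ mcos cos_le1; have [mls als] := Hl _ msin sin_le1.
have [mrc arc] := Hr _ mcos cos_le1; have [mrs ars] := Hr _ msin sin_le1.
(* The Gaussian double integral is turned back into an expectation over [(xiv, etav)]; it then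
   suffices to compare two integrands almost surely. *)
rewrite -(ge0_integral_pair (P := P) (U := xiv) (V := etav) (m1 := gaussian R p)
  (m2 := gaussian R q) (h := fun z => (sq_char_diff
    (A z.1, B z.2))%:E))//; last 3 first.
- exact: gaussian_system_law hxi.
- apply/measurable_EFinP; apply: (measurableT_comp measurable_sq_char_diff).
  by apply: measurable_fun_pair; exact: measurableT_comp.
- by move=> z; rewrite lee_fin sqmod_ge0.
rewrite unlock; apply: ge0_ae_eq_integral => //.
- by apply/measurable_EFinP; exact: measurable_sqmod_subM.
- apply/measurable_EFinP; apply: (measurableT_comp measurable_sq_char_diff).
  by apply: measurable_fun_pair; exact: measurableT_comp.
- by move=> w _; rewrite lee_fin sqmod_ge0.
- by move=> w _; rewrite lee_fin sqmod_ge0.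
(* Six almost sure identities are combined: cosine and sine parts of the joint and of the two
   marginal conditional expectations. *)
apply: filterS (filterI a2c (filterI a2s (filterI alc (filterI als
  (filterI arc ars))))).
move=> w [e2c [e2s [elc [els [erc ers]]]]] _.
congr EFin; rewrite /cond_char_diff /Ccond_expectation /sq_char_diff.
rewrite joint_char_funE (char_funlE P X Y) (char_funrE P X Y) !sqmod_subM.
by rewrite -e2c -e2s -elc -els -erc -ers.
Qed.

End expected_squared_difference.

Section double_radial_integral.
Context {R : realType}.
Local Open Scope ereal_scope.

Lemma integral_double_radial_gaussian p q (e : 'I_p -> p.-tuple R)
    (e' : 'I_q -> q.-tuple R) (alpha : R) (H : Rn R p * Rn R q -> R) :
  (0 < p)%N -> (0 < q)%N -> (0 < alpha)%R ->
  orthonormal_basis e -> orthonormal_basis e' ->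
  measurable_fun setT H -> (forall z, 0 <= H z)%R ->
  \int[lebesgue_measure]_(r in `]0%R, +oo[)
  \int[lebesgue_measure]_(s in `]0%R, +oo[)
    ((\int[gaussian R p]_x \int[gaussian R q]_y
        (H (scalev r (lincomb e x), scalev s (lincomb e' y)))%:E) *
     ((r `^ (alpha + 1) * s `^ (alpha + 1))^-1)%:E) =
  (radial_const alpha p)%:E * ((radial_const alpha q)%:E *
  \int[@lebesgue_measuren R p]_t \int[@lebesgue_measuren R q]_u
    (H (t, u) / (norm2 t `^ (p%:R + alpha) * norm2 u `^ (q%:R + alpha)))%:E).
Proof.
move=> p0 q0 alpha0 he he' mH H0.
have mHE : measurable_fun setT (EFin \o H) by exact/measurable_EFinP.
have HE0 z : 0 <= (H z)%:E by rewrite lee_fin.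
have mnormV n : measurable_fun [set: Rn R n] (fun u => (norm2 u `^
  (n%:R + alpha))^-1)%R.
  under eq_fun do rewrite -powRN.
  exact: (measurableT_comp (measurable_powR _) (@measurable_norm2 R n)).
have normV_ge0 n (u : n.-tuple R) : 0 <= ((norm2 u `^ (n%:R + alpha))^-1)%:E.
  by rewrite lee_fin invr_ge0 powR_ge0.
(* The radial integral in [s] for a fixed first frequency [t]; [FE] evaluates it by the one-radius
   identity, and [F] is then the function to which the identity in [r] applies. *)
pose F t := \int[lebesgue_measure]_(s in `]0%R, +oo[)
  (((s `^ (alpha + 1))^-1)%:E *
   \int[gaussian R q]_y (H (t, scalev s (lincomb e' y)))%:E).
have FE t : F t = (radial_const alpha q)%:E *
    \int[@lebesgue_measuren R q]_u ((H (t, u))%:E * ((norm2 u `^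
      (q%:R + alpha))^-1)%:E).
  rewrite /F (integral_radial_gaussian (f := fun u => (H (t, u))%:E))//.
  exact: (measurable_fun_pair2 _ mHE).
have mHu : measurable_fun setT
    (fun z : Rn R p * Rn R q => (H z)%:E * ((norm2 z.2 `^
      (q%:R + alpha))^-1)%:E).
  apply: emeasurable_funM => //; apply/measurable_EFinP.
  exact: (measurableT_comp (mnormV q) measurable_snd).
have Hu0 (z : Rn R p * Rn R q) : 0 <= (H z)%:E * ((norm2 z.2 `^
  (q%:R + alpha))^-1)%:E.
  by rewrite mule_ge0.
have mF : measurable_fun setT F.
  have -> : F = fun t => (radial_const alpha q)%:E * fubini_F
    (@lebesgue_measuren R q)
      (fun z => (H z)%:E * ((norm2 z.2 `^ (q%:R + alpha))^-1)%:E) t.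
    by apply/funext => t; exact: FE.
  apply: emeasurable_funM => //.
  exact: (measurable_fun_fubini_tonelli_F
    (m2 := @lebesgue_measuren R q) _ mHu Hu0).
have F0 t : 0 <= F t.
  by rewrite FE mule_ge0 ?lee_fin ?radial_const_ge0// integral_ge0// => u _;
    exact: (Hu0 (t, u)).
have mpow : measurable_fun [set: measurableTypeR R] (fun s : R => (s `^
  (alpha + 1))^-1)%R.
  by under eq_fun do rewrite -powRN; exact: measurable_powR.
have pow0 (s : R) : 0 <= ((s `^ (alpha + 1))^-1)%:E.
  by rewrite lee_fin invr_ge0 powR_ge0.
have mD : measurable (`]0%R, +oo[%classic : set (measurableTypeR R)).
  exact: measurable_itv.
transitivity (\int[lebesgue_measure]_(r in `]0%R, +oo[)
    (((r `^ (alpha + 1))^-1)%:E * \int[gaussian R p]_x F (scalev r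
      (lincomb e x)))).
  apply: eq_integral => r _.
  (* With [r] fixed, [s] is kept as a variable beside [x] and [y]: the integral over [y] is then
     jointly measurable in [(s, x)], which allows the [s]-integral to move inside the
     [x]-integral. *)
  pose g (z : (measurableTypeR R * Rn R p) * Rn R q) :=
    (H (scalev r (lincomb e z.1.2), scalev (z.1.1 : R) (lincomb e' z.2)))%:E.
  have mg : measurable_fun setT g.
    apply: (measurableT_comp mHE); apply: measurable_fun_pair.
      apply: measurable_scalev => //; apply: measurable_lincomb.
      by apply: measurableT_comp => //; exact: measurable_fst.
    apply: measurable_scalev; last exact: measurable_lincomb.
    by apply: (measurableT_comp measurable_fst); exact: measurable_fst.
  have g0 z : 0 <= g z by exact: HE0.
  have mQ := measurable_fun_fubini_tonelli_F (m2 := gaussian R q) g mg g0.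
  have Q0 z : 0 <= fubini_F (gaussian R q) g z by exact: integral_ge0.
  have mG := measurable_fun_fubini_tonelli_F (m2 := gaussian R p) _ mQ Q0.
  have G0 s : 0 <= fubini_F (gaussian R p) (fubini_F (gaussian R q) g) s
    by exact: integral_ge0.
  rewrite -(fubini_tonelli_restrict lebesgue_measure (gaussian R p)
    (D := `]0%R, +oo[%classic : set (measurableTypeR R))
    (f := fun z => ((z.1 `^ (alpha + 1))^-1)%:E * fubini_F
      (gaussian R q) g z))//; last 2 first.
  - apply: emeasurable_funM => //; apply/measurable_EFinP.
    exact: (measurableT_comp mpow measurable_fst).
  - by move=> z; rewrite mule_ge0.
  rewrite -ge0_integralZl_EFin//; last 3 first.
  - by move=> s _; apply: integral_ge0 => x _; rewrite mule_ge0.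
  - apply: measurable_funTS.
    rewrite (_ : (fun s => _) = fun s : measurableTypeR R => (((s : R) `^
      (alpha + 1))^-1)%:E *
        fubini_F (gaussian R p) (fubini_F (gaussian R q) g) s); last first.
      apply/funext => s; rewrite /= ge0_integralZl//.
      exact: (measurable_fun_pair2 _ mQ).
    by apply: emeasurable_funM => //; exact/measurable_EFinP.
  - by rewrite invr_ge0 powR_ge0.
  apply: eq_integral => s _.
  rewrite /= ge0_integralZl//; last exact: (measurable_fun_pair2 _ mQ).
  by rewrite invfM EFinM muleC -muleA.
rewrite integral_radial_gaussian//; congr (_ * _).
under eq_integral do rewrite FE -muleA.
have mHtu : measurable_fun setT (fun z : Rn R p * Rn R q =>
    (H z)%:E * ((norm2 z.2 `^ (q%:R + alpha))^-1)%:E * ((norm2 z.1 `^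
      (p%:R + alpha))^-1)%:E).
  apply: emeasurable_funM => //; apply/measurable_EFinP.
  exact: (measurableT_comp (mnormV p) measurable_fst).
have Htu0 (z : Rn R p * Rn R q) :
    0 <= (H z)%:E * ((norm2 z.2 `^ (q%:R + alpha))^-1)%:E * ((norm2 z.1 `^
      (p%:R + alpha))^-1)%:E.
  by rewrite mule_ge0.
transitivity (\int[@lebesgue_measuren R p]_t ((radial_const alpha q)%:E *
    \int[@lebesgue_measuren R q]_u
      ((H (t, u))%:E * ((norm2 u `^ (q%:R + alpha))^-1)%:E * ((norm2 t `^
        (p%:R + alpha))^-1)%:E))).
  apply: eq_integral => t _; congr (_ * _).
  rewrite ge0_integralZr//.
  exact: (measurable_fun_pair2 _ mHu).
rewrite ge0_integralZl_EFin; last 4 first.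
- exact: measurableT.
- by move=> t _; apply: integral_ge0 => u _; exact: (Htu0 (t, u)).
- exact: (measurable_fun_fubini_tonelli_F (m2 := @lebesgue_measuren R q)
    _ mHtu Htu0).
- exact: radial_const_ge0.
congr (_ * _); apply: eq_integral => t _; apply: eq_integral => u _.
by rewrite -!EFinM invfM; congr EFin; ring.
Qed.

End double_radial_integral.

(** * Passing to the extended probability space *)

Section transfer.
Context d (T : measurableType d) (R : realType) (P : probability T R).
Context d' (T' : measurableType d') (P' : probability T' R)
  (pr : {RV P' >-> T}).
Hypothesis hpr : forall A : set T, measurable A -> distribution P' pr A = P A.

(** The bound gives the integrability that the change of variables demands for a function of varying
    sign. *)
Lemma expectation_comp_pr (k : T -> R) : measurable_fun [set: T] k ->
  (forall w, `|k w| <= 1) -> ('E_P'[k \o pr] = 'E_P[k])%E.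
Proof.
move=> mk k1; rewrite unlock.
transitivity (\int[distribution P' pr]_w (k w)%:E)%E.
  rewrite integral_distribution//; first exact/measurable_EFinP.
  apply: (@bounded_integrable _ _ _ P' (k \o pr) 1) => //.
  - exact: measurableT_comp.
  - by move=> w; exact: k1.
by apply: eq_measure_integral => A mA _; exact: hpr.
Qed.

Lemma Cexpectation_expi_comp_pr (k : T -> R) : measurable_fun [set: T] k ->
  Cexpectation P' (fun w => expi (k (pr w))) =
    Cexpectation P (fun w => expi (k w)).
Proof.
move=> mk; rewrite /Cexpectation/=.
have -> : ('E_P'[fun w => cos (k (pr w))] = 'E_P[fun w => cos (k w)])%E.
  apply: (expectation_comp_pr (k := fun w => cos (k w))).
    by apply: measurableT_comp => //; apply: continuous_measurable_fun;
      exact: continuous_cos.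
  by move=> w; rewrite ler_norml cos_geN1 cos_le1.
suff -> : ('E_P'[fun w => sin (k (pr w))] = 'E_P[fun w => sin (k w)])%E by [].
apply: (expectation_comp_pr (k := fun w => sin (k w))).
  by apply: measurableT_comp => //; apply: continuous_measurable_fun;
    exact: continuous_sin.
by move=> w; rewrite ler_norml sin_geN1 sin_le1.
Qed.

End transfer.

Theorem theorem6p2 (R : realType) (alpha : R) (halpha : 0 < alpha < 2)
  (p q : nat) (hp : (1 <= p)%N) (hq : (1 <= q)%N)
  (d : measure_display) (T : measurableType d) (P : probability T R)
  (X : {RV P >-> p.-tuple R}) (Y : {RV P >-> q.-tuple R})
  (d' : measure_display) (T' : measurableType d') (P' : probability T' R)
  (pr : {RV P' >-> T})
  (hpr : forall A : set T, measurable A -> distribution P' pr A = P A)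
  (e : 'I_p -> p.-tuple R) (he : orthonormal_basis e)
  (e' : 'I_q -> q.-tuple R) (he' : orthonormal_basis e')
  (xi : 'I_p -> {RV P' >-> R}) (eta : 'I_q -> {RV P' >-> R})
  (hxi : gaussian_system P' (X \o pr) (Y \o pr) xi eta) :
  dcovE P alpha X Y = dcovH P' (X \o pr) (Y \o pr) e e' xi eta alpha.
Proof.
have [alpha0 _] := andP halpha.
have mX : measurable_fun setT (X : T -> Rn R p) := measurable_funPT X.
have mY : measurable_fun setT (Y : T -> Rn R q) := measurable_funPT Y.
have mXpr : measurable_fun setT (X \o pr : T' -> Rn R p).
  exact: measurableT_comp.
have mYpr : measurable_fun setT (Y \o pr : T' -> Rn R q).
  exact: measurableT_comp.
(* The squared difference is formed on the extension, where the Gaussian variables live; [HE]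
   carries the integrand of dcov^E there. *)
pose H := sq_char_diff P' (X \o pr) (Y \o pr).
have HE t u :
    sqmod (joint_char_fun P X Y t u - char_fun P X t * char_fun P Y u) =
      H (t, u).
  rewrite /H /sq_char_diff /joint_char_fun /char_fun/=.
  rewrite (Cexpectation_expi_comp_pr hpr (k := fun w => dotv t (X w) + dotv u
    (Y w))); last first.
    by apply: measurable_funD; exact: measurable_dotv.
  rewrite (Cexpectation_expi_comp_pr hpr (k := fun w => dotv t (X w)));
    last first.
    exact: measurable_dotv.
  by rewrite (Cexpectation_expi_comp_pr hpr (k := fun w => dotv u (Y w)))//;
    exact: measurable_dotv.
rewrite /dcovE; under [in LHS]eq_integral => t _.
  under eq_integral => u _ do rewrite HE.
  over.
rewrite /dcovH; under [in RHS]eq_integral => r _.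
  under eq_integral => s _ do
    rewrite (expectation_sqmod_cond_char_diff mXpr mYpr e e' hxi r s).
  over.
rewrite (integral_double_radial_gaussian hp hq alpha0 he he'); last 2 first.
- exact: measurable_sq_char_diff.
- by move=> z; exact: sqmod_ge0.
have EFinM4 (a b c : R) (x : \bar R) :
    (a%:E * (b%:E * (c%:E * x)) = (a * b * c)%:E * x)%E.
  by rewrite !muleA -!EFinM.
(* The two factors [cH_const alpha] produced by [c_constE] make up the square in front of dcov^H. *)
rewrite EFinM4 !c_constE (mulrACA (cH_const alpha)) -expr2.
by rewrite (mulrA (cH_const alpha ^+ 2)).
Qed.
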